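(* Let $U \subset \mathbb{C}$ be a connected open neighborhood of $\overline{\mathbb{D}}$, and let $f$ be a holomorphic function on $U$ that is not identically zero. Let $p_1,\dots,p_m \in \mathbb{D}$ be all the (distinct) zeros of $f$ in $\mathbb{D}$, with multiplicities $k_1,\dots,k_m$, and let $q_1,\dots,q_r \in \partial\mathbb{D}$ be all the (distinct) zeros of $f$ on $\partial \mathbb{D}$, with multiplicities $\ell_1,\dots,\ell_r$. Assume that $m+r\ge 1$, and define $$\kappa := \max\{k_1,\dots,k_m,\ell_1,\dots,\ell_r\}.$$ For $\varepsilon>0$ set $\Gamma_\varepsilon := \{z\in\mathbb{D}: |f(z)|=\varepsilon\}$ and $E_\varepsilon := \{z\in\mathbb{D}: |f(z)|<\varepsilon\}$. Then there exist constants $C>0$ and $\varepsilon_0>0$ such that, for all $0<\varepsilon<\varepsilon_0$, $$\mathcal{H}^1(\Gamma_\varepsilon)\le C\varepsilon^{1/\kappa}\qquad\text{and}\qquad \operatorname{Area}(E_\varepsilon)\le C\varepsilon^{2/\kappa}.$$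
   Context: $\mathbb{D}=\{z\in\mathbb{C}:|z|<1\}$ is the unit disk. $\mathcal{H}^1$ is one-dimensional Hausdorff measure and $\operatorname{Area}$ is two-dimensional Lebesgue measure on $\mathbb{C}\cong\mathbb{R}^2$. One of the two lists of zeros may be empty. *)

(* Defs.v *)
From HB Require Import structures.
From mathcomp Require Import all_boot all_order all_algebra.
From mathcomp Require Import complex.
From mathcomp Require Import all_classical all_reals all_analysis.
Set Implicit Arguments.
Unset Strict Implicit.
Unset Printing Implicit Defensive.
Import Order.TTheory GRing.Theory Num.Theory.
Import numFieldNormedType.Exports.
Local Open Scope classical_set_scope.
Local Open Scope ring_scope.

(* The complex numbers, sealed behind a numClosedFieldType so that the normed
   space structure over itself that numFieldNormedType gives to every such field
   is found: derivability over the scalar field Cplx R is complex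
   differentiability. *)
Definition Cplx (R : realType) : numClosedFieldType := R[i].

Section definitions.
Variable R : realType.
Local Notation C := (Cplx R).
Implicit Types (z a : C) (U A : set C) (f : C -> C).

(* The norm of Cplx R as a numDomainType is itself Cplx R-valued; this is the
   real-valued modulus. *)
Definition cabs z : R := ComplexField.Normc.normc z.

Definition unit_disk : set C := [set z | cabs z < 1].
Definition closed_unit_disk : set C := [set z | cabs z <= 1].
Definition unit_circle : set C := [set z | cabs z = 1].

(* A function on U is represented by a total function whose values outside U
   are irrelevant. *)
Definition holomorphic_on U f := forall z, U z -> derivable f z 1.

(* For a zero a of f, this says that a has multiplicity n. *)
Definition has_order U f a (n : nat) :=
  exists g : C -> C,
    [/\ holomorphic_on U g, g a != 0 &
        forall z, U z -> f z = (z - a) ^+ n * g z].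

Local Open Scope ereal_scope.

(* The element 0 is added because the supremum of the empty set is -oo. *)
Definition diam A : \bar R :=
  ereal_sup ([set 0] `|` [set (cabs (z.1 - z.2))%:E | z in A `*` A]).

Definition hausdorff1_delta (delta : R) A : \bar R :=
  ereal_inf [set \sum_(0 <= j <oo) diam (B j) | B in
    [set B : nat -> set C |
      A `<=` \bigcup_j B j /\ forall j, diam (B j) <= delta%:E]].

Definition hausdorff1 A : \bar R :=
  ereal_sup [set hausdorff1_delta delta A | delta in [set d : R | (0 < d)%R]].

Definition area A : \bar R :=
  (@lebesgue_measure R \x @lebesgue_measure R)
    [set xy : R * R | A (Complex xy.1 xy.2)].

Local Close Scope ereal_scope.

Definition level_set f (e : R) : set C :=
  [set z | unit_disk z /\ cabs (f z) = e].
Definition sublevel_set f (e : R) : set C :=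
  [set z | unit_disk z /\ cabs (f z) < e].

End definitions.

Arguments unit_disk {R}.
Arguments closed_unit_disk {R}.
Arguments unit_circle {R}.

(* Main.v *)
(* Near a zero a of order n write f = (z - a)^n g with g a != 0.  Where |g| >= c
   the set |f| < e lies in the disk of radius (e/c)^(1/n) about a, and by
   compactness of the closed disk small values of |f| occur only near the zeros;
   this gives the area bound.  For the length bound it is enough that g be
   Lipschitz near a: if |f z| = |f w| then n log|z - a| + log|g z| takes the same
   value at w, so | |z - a| - |w - a| | is at most |z - w| / 2 close to a, the
   level curve is a Lipschitz graph over the circle of directions, and cutting
   that circle into N arcs covers the curve by O(N) sets of diameter
   O(e^(1/n) / N).

   Holomorphic means complex differentiable, with no continuity of the derivative,
   so the Lipschitz property rests on a form of Cauchy's estimate.  Goursat's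
   bisection gives primitives G of g and K_b of (g(z) - g(b)) / (z - b).  Along
   the circle w = r exp(i t) the function K_b(b + w) - G(b + w) / w has derivative
   i (G(b + w) / w - g(b)) in t and is periodic, so Rolle's theorem for the
   difference of two such functions bounds g(b) - g(c) by
   max |G(b + w) - G(c + w)| / r, that is, by a multiple of |b - c|. *)
Require Import Defs.
From HB Require Import structures.
From mathcomp Require Import all_boot all_order all_algebra.
From mathcomp Require Import complex.
From mathcomp Require Import all_classical all_reals all_analysis.
From mathcomp Require Import ring lra.
Set Implicit Arguments.
Unset Strict Implicit.
Unset Printing Implicit Defensive.
Import Order.TTheory GRing.Theory Num.Theory.
Import numFieldNormedType.Exports.
Local Open Scope classical_set_scope.
Local Open Scope ring_scope.

(** * Primitives of closed 1-forms *)

Section one_variable.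
Variable R : realType.
Implicit Types (u F : R -> R) (a b c : R).

Lemma antiderivative_exists u a b :
  (forall x, a <= x <= b -> {for x, continuous u}) ->
  exists F, forall x, a < x < b -> is_derive x 1 F (u x).
Proof.
move=> cu; exists (fun x => \int[lebesgue_measure]_(t in `[a, x]) u t)%R.
move=> x /andP[ax xb].
have ui : lebesgue_measure.-integrable `[a, b] (EFin \o u).
  apply: continuous_compact_integrable; first exact: segment_compact.
  apply: continuous_in_subspaceT => y /set_mem /=.
  by rewrite in_itv /= => /cu.
have [|dF F'] := continuous_FTC1_closed xb ui ax.
  by apply: cu; lra.
by apply: DeriveDef; [exact: dF|rewrite -F' derive1E].
Qed.

(** The mean value theorem compares the increment of [F] with the slope [k]. The points [s] and [t]
    come in either order because half-sides of rectangles may be negative. *)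
Lemma mean_value_bound u F (c w k e s t : R) :
  (forall x, `|x - c| <= w -> is_derive x 1 F (u x)) ->
  (forall x, `|x - c| <= w -> `|u x - k| <= e) ->
  `|s - c| <= w -> `|t - c| <= w ->
  `|F t - F s - k * (t - s)| <= e * `|t - s|.
Proof.
move=> dF ue; wlog st : s t / s <= t.
  move=> H sc tc; have [|/ltW] := leP s t; first by move=> /H; exact.
  move=> /H /(_ tc sc); rewrite [`|s - t|]distrC; apply: le_trans.
  by rewrite -normrN le_eqVlt; apply/orP; left; apply/eqP; congr `|_|; ring.
move=> sc tc.
have inw (x : R) : x \in `[s, t]%R -> `|x - c| <= w.
  by move: sc tc; rewrite in_itv /= !ler_norml; lra.
have [||y yst ->] := @MVT_segment R F u s t st.
- by move=> x xst; apply/dF/inw/subset_itv_oo_cc.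
- apply: continuous_in_subspaceT => x /set_mem /= xst.
  apply: differentiable_continuous; apply/derivable1_diffP.
  by case: (dF _ (inw _ xst)).
- by rewrite -mulrBl normrM ler_wpM2r // ue // inw.
Qed.

Lemma normr_segment_lt (c u v t s : R) :
  `|u - c| < s -> `|v - c| < s -> 0 <= t <= 1 -> `|u + t * (v - u) - c| < s.
Proof.
move=> us vs /andP[t0 t1].
rewrite (_ : _ - c = (1 - t) * (u - c) + t * (v - c)); last by ring.
apply: (le_lt_trans (ler_normD _ _)); rewrite !normrM (ger0_norm t0).
rewrite ger0_norm ?subr_ge0 //.
have: Num.max `|u - c| `|v - c| < s by rewrite gt_max us vs.
apply: le_lt_trans; set m := Num.max _ _.
rewrite -[leRHS]mul1r -[in leRHS](subrK t 1) [leRHS]mulrDl.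
by rewrite lerD // ler_wpM2l ?subr_ge0 // le_max lexx ?orbT.
Qed.

(** The intervals of center [x n] and radius [w / 2 ^+ n] are nested; the limit is the supremum of
    their lower ends. *)
Lemma dyadic_limit (x : nat -> R) (w : R) :
  (forall n, `|x n.+1 - x n| <= w / 2 ^+ n.+1) ->
  exists l, forall n, `|l - x n| <= w / 2 ^+ n.
Proof.
move=> H.
have E n : w / 2 ^+ n = w / 2 ^+ n.+1 + w / 2 ^+ n.+1.
  by rewrite exprS; field; rewrite expf_neq0.
have w0 n : 0 <= w / 2 ^+ n by rewrite E addr_ge0 // (le_trans _ (H n)).
have lo n k : x n - w / 2 ^+ n <= x (n + k)%N - w / 2 ^+ (n + k).
  elim: k => [|k IH]; first by rewrite addn0.
  apply: (le_trans IH); rewrite addnS; move: (H (n + k)%N) (E (n + k)%N).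
  by rewrite ler_norml; lra.
have hi n k : x (n + k)%N + w / 2 ^+ (n + k) <= x n + w / 2 ^+ n.
  elim: k => [|k IH]; first by rewrite addn0.
  apply: le_trans IH; rewrite addnS; move: (H (n + k)%N) (E (n + k)%N).
  by rewrite ler_norml; lra.
have lohi m n : x m - w / 2 ^+ m <= x n + w / 2 ^+ n.
  apply: (le_trans (lo m n)); apply: le_trans (hi n m); rewrite addnC.
  by move: (w0 (n + m)%N); lra.
pose S := range (fun n => x n - w / 2 ^+ n).
have S0 : S !=set0 by exists (x 0%N - w / 2 ^+ 0); exists 0%N.
have ubS n : ubound S (x n + w / 2 ^+ n) by move=> _ [m _ <-]; exact: lohi.
exists (sup S) => n; rewrite ler_norml; apply/andP; split.
  suff : x n - w / 2 ^+ n <= sup S by lra.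
  by apply: ub_le_sup; [exists (x 0%N + w / 2 ^+ 0)|exists n].
suff : sup S <= x n + w / 2 ^+ n by lra.
exact: ge_sup.
Qed.

(** Subtracting a quadratic removes the linear term of the derivative along an edge and leaves a
    derivative close to a constant. *)
Lemma is_derive_sub_square F (a x0 x du : R) : is_derive x 1 F du ->
  is_derive x 1 (fun t => F t - a / 2 * (t - x0) ^+ 2) (du - a * (x - x0)).
Proof.
move=> dF; pose sq : R -> R := (a / 2) *: ((id - cst x0 : R -> R) ^+ 2).
apply: (@is_derive_eq _ _ _ (F - sq)).
rewrite subr0 /= expr1 -[(id - cst x0) x]/(x - x0).
by rewrite -![_ *: _]/(_ * _); field.
Qed.

End one_variable.

(** * Goursat's lemma on rectangles *)

Section closed_forms.
Variable R : realType.
Implicit Types (p q P Q F : R -> R -> R) (x y c d w h e s : R).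

(* The circulation of dP (along horizontal edges) and dQ (along vertical ones)
   around the rectangle of center (c, d) and half-sides w and h, which may be
   negative. *)
Definition circulation P Q c d w h : R :=
  (P (c + w) (d - h) - P (c - w) (d - h)) +
  (Q (c + w) (d + h) - Q (c + w) (d - h)) -
  (P (c + w) (d + h) - P (c - w) (d + h)) -
  (Q (c - w) (d + h) - Q (c - w) (d - h)).

(** An edge shared by two of the four quarters is traversed once in each direction and cancels. *)
Lemma circulation_split P Q c d w h :
  circulation P Q c d w h =
    circulation P Q (c + w / 2) (d + h / 2) (w / 2) (h / 2) +
    circulation P Q (c + w / 2) (d - h / 2) (w / 2) (h / 2) +
    circulation P Q (c - w / 2) (d + h / 2) (w / 2) (h / 2) +
    circulation P Q (c - w / 2) (d - h / 2) (w / 2) (h / 2).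
Proof.
have E (z t : R) : [/\ z + t / 2 + t / 2 = z + t, z + t / 2 - t / 2 = z,
    z - t / 2 - t / 2 = z - t & z - t / 2 + t / 2 = z] by split; field.
rewrite /circulation; have [-> -> -> ->] := E c w.
by have [-> -> -> ->] := E d h; ring.
Qed.

(** Closedness of [p dx + q dy] at a point: both coefficients are differentiable there, and the
    shared [b] says that the two cross derivatives agree. *)
Definition closed_at p q x y := exists a b c,
  forall e, 0 < e -> exists2 r, 0 < r &
    forall x' y', `|x' - x| <= r -> `|y' - y| <= r ->
      `|p x' y' - p x y - a * (x' - x) - b * (y' - y)|
        <= e * (`|x' - x| + `|y' - y|) /\
      `|q x' y' - q x y - b * (x' - x) - c * (y' - y)|
        <= e * (`|x' - x| + `|y' - y|).

(** The affine part of a closed form has zero circulation. The remainder is small relative to the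
    size of the rectangle and is integrated over a length of that same size. *)
Lemma circulation_small P Q p q x0 y0 e : closed_at p q x0 y0 -> 0 < e ->
  exists2 r, 0 < r & forall c d w h,
    `|w| <= r -> `|h| <= r -> `|x0 - c| <= `|w| -> `|y0 - d| <= `|h| ->
    (forall x y, `|x - c| <= `|w| -> `|y - d| <= `|h| ->
       is_derive x 1 (P^~ y) (p x y) /\ is_derive y 1 (Q x) (q x y)) ->
    `|circulation P Q c d w h| <= e * (`|w| + `|h|) ^+ 2.
Proof.
(* Points of the rectangle are within twice the half-sides of [(x0, y0)], hence [r / 2] and an edge
   error [e / 4 * (W + K)] per unit length; the edges have lengths [2 * W] and [2 * K]. *)
move=> [a [b [k H]]] e0; have e80 : 0 < e / 8 by lra.
have [r r0 {}H] := H _ e80; exists (r / 2); first by lra.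
move=> c d w h wr hr x0c y0d dPQ.
set W := `|w| in wr x0c dPQ *; set K := `|h| in hr y0d dPQ *.
have cw : `|c + w - c| <= W /\ `|c - w - c| <= W.
  by rewrite addrAC subrr add0r addrAC subrr add0r normrN.
have dh : `|d + h - d| <= K /\ `|d - h - d| <= K.
  by rewrite addrAC subrr add0r addrAC subrr add0r normrN.
have near_x x : `|x - c| <= W -> `|x - x0| <= 2 * W.
  by move: x0c; rewrite !ler_norml; lra.
have near_y y : `|y - d| <= K -> `|y - y0| <= 2 * K.
  by move: y0d; rewrite !ler_norml; lra.
have loc x y : `|x - c| <= W -> `|y - d| <= K ->
    `|p x y - p x0 y0 - a * (x - x0) - b * (y - y0)| <= e / 4 * (W + K) /\
    `|q x y - q x0 y0 - b * (x - x0) - k * (y - y0)| <= e / 4 * (W + K).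
  move=> /near_x xc /near_y yc.
  have [|| E1 E2] := H x y; [lra|lra|].
  have E : e / 8 * (`|x - x0| + `|y - y0|) <= e / 4 * (W + K).
    rewrite (_ : e / 4 * _ = e / 8 * (2 * W + 2 * K)); last by field.
    by rewrite ler_pM2l // lerD.
  by split; [exact: le_trans E1 E|exact: le_trans E2 E].
have hor y : `|y - d| <= K ->
    `|P (c + w) y - P (c - w) y - a * (c - x0) * (2 * w)
      - (p x0 y0 + b * (y - y0)) * (2 * w)| <= e / 4 * (W + K) * (2 * W).
  move=> yd.
  have := @mean_value_bound R (fun x => p x y - a * (x - x0))
    (fun x => P x y - a / 2 * (x - x0) ^+ 2) c W (p x0 y0 + b * (y - y0))
    (e / 4 * (W + K)) (c - w) (c + w).
  rewrite (_ : c + w - (c - w) = 2 * w); last by ring.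
  rewrite normrM [`|2|]gtr0_norm //.
  move=> /(_ _ _ cw.2 cw.1) H1; apply: le_trans (H1 _ _).
  - by rewrite le_eqVlt; apply/orP; left; apply/eqP; congr `|_|; field.
  - move=> x xc; have [dP _] := dPQ x y xc yd.
    exact: is_derive_sub_square.
  - move=> x xc; rewrite (_ : _ - _ - _ =
      p x y - p x0 y0 - a * (x - x0) - b * (y - y0)); last by ring.
    by have [] := loc x y xc yd.
have ver x : `|x - c| <= W ->
    `|Q x (d + h) - Q x (d - h) - k * (d - y0) * (2 * h)
      - (q x0 y0 + b * (x - x0)) * (2 * h)| <= e / 4 * (W + K) * (2 * K).
  move=> xc.
  have := @mean_value_bound R (fun y => q x y - k * (y - y0))
    (fun y => Q x y - k / 2 * (y - y0) ^+ 2) d K (q x0 y0 + b * (x - x0))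
    (e / 4 * (W + K)) (d - h) (d + h).
  rewrite (_ : d + h - (d - h) = 2 * h); last by ring.
  rewrite normrM [`|2|]gtr0_norm //.
  move=> /(_ _ _ dh.2 dh.1) H1; apply: le_trans (H1 _ _).
  - by rewrite le_eqVlt; apply/orP; left; apply/eqP; congr `|_|; field.
  - move=> y yd; have [_ dQ] := dPQ x y xc yd.
    exact: is_derive_sub_square.
  - move=> y yd; rewrite (_ : _ - _ - _ =
      q x y - q x0 y0 - b * (x - x0) - k * (y - y0)); last by ring.
    by have [] := loc x y xc yd.
(* The terms in [a], [k] and the constants cancel between opposite edges; those in [b] contribute
   [4 * b * w * h] with both signs. *)
have := hor _ dh.1; have := hor _ dh.2; have := ver _ cw.1; have := ver _ cw.2.
rewrite (_ : e * (W + K) ^+ 2 = e / 4 * (W + K) * (2 * W) +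
  e / 4 * (W + K) * (2 * W) + e / 4 * (W + K) * (2 * K) +
  e / 4 * (W + K) * (2 * K)); last by field.
rewrite /circulation !ler_norml; lra.
Qed.

(** Bisection: some quarter carries at least a quarter of the circulation. The chosen quarters
    shrink to a point, where the local estimate beats the factor [4 ^+ n]. *)
Lemma goursat P Q p q c d w h :
  (forall x y, `|x - c| <= `|w| -> `|y - d| <= `|h| ->
     [/\ is_derive x 1 (P^~ y) (p x y), is_derive y 1 (Q x) (q x y) &
         closed_at p q x y]) ->
  circulation P Q c d w h = 0.
Proof.
move=> H.
pose J n (z : R * R) := circulation P Q z.1 z.2 (w / 2 ^+ n) (h / 2 ^+ n).
have half (t : R) n : t / 2 ^+ n.+1 = t / 2 ^+ n / 2.
  by rewrite exprS; field; rewrite expf_neq0.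
have step (nz : nat * (R * R)) : exists z' : R * R,
    [/\ `|z'.1 - nz.2.1| <= `|w| / 2 ^+ nz.1.+1,
        `|z'.2 - nz.2.2| <= `|h| / 2 ^+ nz.1.+1 &
        `|J nz.1 nz.2| <= 4 * `|J nz.1.+1 z'|].
  case: nz => n [x y] /=.
  have N (t : R) : `|t| / 2 ^+ n.+1 = `|t / 2 ^+ n / 2|.
    by rewrite -half normrM normfV [`|_ ^+ _|]gtr0_norm // exprn_gt0.
  rewrite !N; set w' := w / 2 ^+ n; set h' := h / 2 ^+ n.
  have := circulation_split P Q x y w' h'.
  rewrite -[circulation P Q x y w' h']/(J n (x, y)).
  rewrite /w' /h' -!half; set W := w / 2 ^+ n.+1; set K := h / 2 ^+ n.+1.
  set A1 := circulation _ _ _ _ _ _; set A2 := circulation _ _ _ _ _ _.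
  set A3 := circulation _ _ _ _ _ _; set A4 := circulation _ _ _ _ _ _.
  move=> JE; have NT (u v : R) : `|u + v - u| <= `|v|.
    by rewrite addrAC subrr add0r.
  have NT' (u v : R) : `|u - v - u| <= `|v| by rewrite addrAC subrr add0r
    normrN.
  have [K1|K1] := leP `|J n (x, y)| (4 * `|A1|);
    first by exists (x + W, y + K); split=> /=.
  have [K2|K2] := leP `|J n (x, y)| (4 * `|A2|);
    first by exists (x + W, y - K); split=> /=.
  have [K3|K3] := leP `|J n (x, y)| (4 * `|A3|);
    first by exists (x - W, y + K); split=> /=.
  exists (x - W, y - K); split=> //=.
  have := ler_normD (A1 + A2 + A3) A4; rewrite -JE.
  have := ler_normD (A1 + A2) A3; have := ler_normD A1 A2.
  by rewrite /J /= -/A4; lra.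
have [f Hf] := choice step.
pose z := fix z n := if n is m.+1 then f (m, z m) else (c, d).
have zS n : z n.+1 = f (n, z n) by [].
have [x0 Hx] : exists l, forall n, `|l - (z n).1| <= `|w| / 2 ^+ n.
  by apply: dyadic_limit => n; rewrite zS; have [] := Hf (n, z n).
have [y0 Hy] : exists l, forall n, `|l - (z n).2| <= `|h| / 2 ^+ n.
  by apply: dyadic_limit => n; rewrite zS; have [] := Hf (n, z n).
have Jn n : `|circulation P Q c d w h| <= 4 ^+ n * `|J n (z n)|.
  elim: n => [|n IH]; first by rewrite expr0 mul1r /J /= !expr0 !divr1.
  apply: (le_trans IH); rewrite exprSr -mulrA ler_pM2l ?exprn_gt0 //.
  by have [] := Hf (n, z n).
(* The slack [|w| / 2 ^+ n] keeps the whole n-th rectangle, and not only its center, inside the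
   first one. *)
have inR n : `|(z n).1 - c| <= `|w| - `|w| / 2 ^+ n /\
             `|(z n).2 - d| <= `|h| - `|h| / 2 ^+ n.
  elim: n => [|n [IH1 IH2]];
    first by rewrite /= !subrr !expr0 !divr1 !subrr normr0.
  have := Hf (n, z n); rewrite -zS /= => -[h1 h2 _].
  move: h1 h2 IH1 IH2; rewrite !half !ler_norml; lra.
have [||_ _ cl] := H x0 y0.
- by have := Hx 0%N; rewrite /= expr0 divr1.
- by have := Hy 0%N; rewrite /= expr0 divr1.
apply/eqP; rewrite -normr_le0; apply/ler_addgt0Pl => e e0; rewrite addr0.
(* Adding 1 keeps [S] positive for a degenerate rectangle. *)
set S := (`|w| + `|h|) ^+ 2 + 1.
have S0 : 0 < S by rewrite /S ltr_wpDl // exprn_ge0 // addr_ge0.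
have [r r0 Hr] := circulation_small P Q cl (divr_gt0 e0 S0).
have [n Hn] : exists n, (`|w| + `|h|) / 2 ^+ n <= r.
  exists (Num.bound ((`|w| + `|h|) / r)).
  rewrite ler_pdivrMr ?exprn_gt0 // mulrC -ler_pdivrMr //.
  exact/ltW/upper_nthrootP.
have N (t : R) : `|t / 2 ^+ n| = `|t| / 2 ^+ n.
  by rewrite normrM normfV [`|_ ^+ _|]gtr0_norm // exprn_gt0.
have w0 (t : R) : 0 <= `|t| / 2 ^+ n by rewrite divr_ge0 // exprn_ge0.
have {}Hr : `|J n (z n)| <= e / S * ((`|w| + `|h|) / 2 ^+ n) ^+ 2.
  rewrite [(_ + _) / _]mulrDl -!N; apply: Hr; rewrite ?N //.
  - by move: Hn (w0 h); rewrite mulrDl; lra.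
  - by move: Hn (w0 w); rewrite mulrDl; lra.
  - move=> x y xz yz; have [||? ?] := H x y; last by [].
    + by have [+ _] := inR n; move: xz; rewrite !ler_norml; lra.
    + by have [_ +] := inR n; move: yz; rewrite !ler_norml; lra.
apply: (le_trans (Jn n)).
have {}Hr : 4 ^+ n * `|J n (z n)| <= e / S * (`|w| + `|h|) ^+ 2.
  rewrite (_ : e / S * _ = 4 ^+ n * (e / S * ((`|w| + `|h|) / 2 ^+ n) ^+ 2)).
    by rewrite ler_pM2l // exprn_gt0.
  have -> : 4 ^+ n = (2 ^+ n) ^+ 2 :> R by rewrite -exprM mulnC exprM;
    congr (_ ^+ n); ring.
  by field; rewrite ?lt0r_neq0 ?exprn_gt0.
apply: (le_trans Hr); rewrite -mulrA ger_pMr // ler_pdivrMl // mulr1.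
by rewrite /S; lra.
Qed.

End closed_forms.

(** * Primitives of closed forms on a square *)

Section primitives.
Variable R : realType.
Implicit Types (p q P Q F : R -> R -> R) (x y c d w h e s : R).

Definition jointly_continuous_at p q x y :=
  forall e, 0 < e -> exists2 r, 0 < r &
    forall x' y', `|x' - x| <= r -> `|y' - y| <= r ->
      `|p x' y' - p x y| <= e /\ `|q x' y' - q x y| <= e.

Definition has_differential F (a b x y : R) :=
  forall e, 0 < e -> exists2 r, 0 < r &
    forall x' y', `|x' - x| <= r -> `|y' - y| <= r ->
      `|F x' y' - F x y - a * (x' - x) - b * (y' - y)|
        <= e * (`|x' - x| + `|y' - y|).

(** [F] integrates from [(b1, b2)] along a horizontal and then a vertical edge. Zero circulation
    identifies this with the integral along the other two edges, so both partial derivatives can be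
    read off. At [(b1, b2)] only continuity is assumed, as suits a difference quotient whose value
    at the base point is filled in. *)
Lemma closed_form_primitive p q (cx cy s b1 b2 : R) :
  `|b1 - cx| < s -> `|b2 - cy| < s ->
  (forall x y, `|x - cx| <= s -> `|y - cy| <= s ->
     jointly_continuous_at p q x y) ->
  (forall x y, `|x - cx| <= s -> `|y - cy| <= s -> (x, y) <> (b1, b2) ->
     closed_at p q x y) ->
  exists F, forall x y, `|x - cx| < s -> `|y - cy| < s ->
    has_differential F (p x y) (q x y) x y.
Proof.
move=> b1s b2s cpq dpq.
have [P dP] : exists P, forall x y, `|x - cx| < s -> `|y - cy| < s ->
    is_derive x 1 (P^~ y) (p x y).
  have /choice[P dP] : forall y, exists Py : R -> R, forall x, `|x - cx| < s ->
      `|y - cy| < s -> is_derive x 1 Py (p x y).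
    move=> y; have [ys|ys] := ltP `|y - cy| s; last by exists 0.
    have [|Py dPy] := @antiderivative_exists R (p^~ y) (cx - s) (cx + s).
      move=> x xs; apply/cvgrPdist_le => e e0.
      have [||r r0 Hr] := cpq x y _ _ e e0; [by rewrite ler_norml;
        lra|exact: ltW|].
      near=> x'; rewrite distrC; apply: (Hr _ _ _ _).1.
        rewrite distrC; near: x'; exact: cvgr_dist_le.
      by rewrite subrr normr0 ltW.
    by exists Py => x; rewrite ltr_norml => xs _; apply: dPy; lra.
  by exists (fun x y => P y x) => x y xs ys; exact: dP.
have /choice[Q dQ] : forall x, exists Qx : R -> R, forall y, `|x - cx| < s ->
    `|y - cy| < s -> is_derive y 1 Qx (q x y).
  move=> x; have [xs|xs] := ltP `|x - cx| s; last by exists 0.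
  have [|Qx dQx] := @antiderivative_exists R (q x) (cy - s) (cy + s).
    move=> y ys; apply/cvgrPdist_le => e e0.
    have [||r r0 Hr] := cpq x y _ _ e e0; [exact: ltW|by rewrite ler_norml;
      lra|].
    near=> y'; rewrite distrC; apply: (Hr _ _ _ _).2.
      by rewrite subrr normr0 ltW.
    rewrite distrC; near: y'; exact: cvgr_dist_le.
  by exists Qx => y _; rewrite ltr_norml => ys; apply: dQx; lra.
pose J x1 y1 x2 y2 := (P x2 y1 - P x1 y1) + (Q x2 y2 - Q x2 y1) -
  (P x2 y2 - P x1 y2) - (Q x1 y2 - Q x1 y1).
have between (c t x1 x2 : R) : `|x1 - c| < s -> `|x2 - c| < s ->
    `|t - (x1 + x2) / 2| <= `|(x2 - x1) / 2| -> `|t - c| < s.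
  have [x12|x12] := leP 0 ((x2 - x1) / 2).
    by rewrite (ger0_norm x12) !ltr_norml ler_norml; lra.
  by rewrite (ltr0_norm x12) !ltr_norml ler_norml; lra.
have J0 x1 y1 x2 y2 : `|x1 - cx| < s -> `|y1 - cy| < s ->
    `|x2 - cx| < s -> `|y2 - cy| < s ->
    ~ (`|b1 - (x1 + x2) / 2| <= `|(x2 - x1) / 2| /\
       `|b2 - (y1 + y2) / 2| <= `|(y2 - y1) / 2|) -> J x1 y1 x2 y2 = 0.
  move=> x1s y1s x2s y2s nb.
  have E (u v : R) : (u + v) / 2 + (v - u) / 2 = v /\ (u + v) / 2 - (v - u) / 2
    = u.
    by split; field.
  have := @goursat R P Q p q ((x1 + x2) / 2) ((y1 + y2) / 2)
    ((x2 - x1) / 2) ((y2 - y1) / 2).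
  rewrite /circulation; have [-> ->] := E x1 x2; have [-> ->] := E y1 y2; apply.
  move=> x y xr yr; have xs := between _ _ _ _ x1s x2s xr.
  have ys := between _ _ _ _ y1s y2s yr.
  split; [exact: dP|exact: dQ|apply: dpq; [exact: ltW|exact: ltW|]].
  by move=> [xb yb]; apply: nb; rewrite -xb -yb.
have loc x y e : `|x - cx| < s -> `|y - cy| < s -> 0 < e ->
    exists2 r, 0 < r & forall x' y', `|x' - x| <= r -> `|y' - y| <= r ->
      `|P x' y' - P x y' - p x y * (x' - x)| <= e * `|x' - x| /\
      `|Q x' y' - Q x' y - q x y * (y' - y)| <= e * `|y' - y|.
  move=> xs ys e0; have [r r0 Hr] := cpq x y (ltW xs) (ltW ys) e e0.
  pose r1 := Num.min (r / 2) (Num.min ((s - `|x - cx|) / 2) ((s - `|y - cy|) /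
    2)).
  exists r1; first by rewrite !lt_min; lra.
  move=> x' y'; rewrite !le_min => /and3P[xr xr1 _] /and3P[yr _ yr1].
  have xb u : `|u - x| <= `|x' - x| -> `|u - cx| < s.
    by move=> ux; have := ler_distD x u cx; lra.
  have yb u : `|u - y| <= `|y' - y| -> `|u - cy| < s.
    by move=> uy; have := ler_distD y u cy; lra.
  split.
    apply: (@mean_value_bound R (p^~ y') (P^~ y') x `|x' - x|) => //.
    - by move=> u ux; apply: dP; [exact: xb|exact: yb].
    - by move=> u ux; apply: (Hr _ _ _ _).1; lra.
    - by rewrite subrr normr0.
  apply: (@mean_value_bound R (q x') (Q x') y `|y' - y|) => //.
  - by move=> u uy; apply: dQ; [exact: xb|exact: yb].
  - by move=> u uy; apply: (Hr _ _ _ _).2; lra.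
  - by rewrite subrr normr0.
(* A rectangle with a corner at [(b1, b2)] is cut into a small one at that corner and two that avoid
   the point. *)
have Jb x y : `|x - cx| < s -> `|y - cy| < s -> J b1 b2 x y = 0.
  move=> xs ys; have [->|xb1] := eqVneq x b1; first by rewrite /J; ring.
  have [->|yb2] := eqVneq y b2; first by rewrite /J; ring.
  apply/eqP; rewrite -normr_le0; apply/ler_addgt0Pl => e e0; rewrite addr0.
  have [r r0 Hr] := loc _ _ 1 b1s b2s ltr01.
  set T := `|x - b1| + `|y - b2|.
  have T0 : 0 < T by rewrite ltr_wpDr // normr_gt0 subr_eq0.
  (* [l * T] is the sum of the sides of the corner rectangle. It is at most [r] for the local
     estimate to apply; the four edge errors add up to at most [2 * (l * T)], hence the halved
     [e]. *)
  pose l := Num.min 1 (Num.min (r / T) (e / T / 2)).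
  have l0 : 0 < l by rewrite !lt_min ltr01 !divr_gt0.
  have [l1 lr le] : [/\ l <= 1, l * T <= r & l * T <= e / 2].
    have : l <= l by []; rewrite {2}/l !le_min => /and3P[-> lr le]; split => //.
      by rewrite -ler_pdivlMr.
    by rewrite -ler_pdivlMr // mulrAC.
  pose x' := b1 + l * (x - b1); pose y' := b2 + l * (y - b2).
  have x's : `|x' - cx| < s by apply: normr_segment_lt => //; lra.
  have y's : `|y' - cy| < s by apply: normr_segment_lt => //; lra.
  have far (t u : R) : u != t ->
      ~ `|t - (t + l * (u - t) + u) / 2| <= `|(u - (t + l * (u - t))) / 2|.
    move=> ut; rewrite (_ : t - _ = - ((1 + l) / 2 * (u - t))); last by field.
    rewrite (_ : (u - _) / 2 = (1 - l) / 2 * (u - t)); last by field.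
    rewrite normrN !normrM ler_pM2r ?normr_gt0 ?subr_eq0 //.
    by rewrite !ger0_norm; lra.
  have -> : J b1 b2 x y = J b1 b2 x' y' + J x' b2 x y + J b1 y' x' y.
    by rewrite /J; ring.
  rewrite (J0 x' b2 x y) //; last by move=> [+ _]; exact: far.
  rewrite (J0 b1 y' x' y) //; last by move=> [_]; exact: far.
  have E1 : `|x' - b1| + `|y' - b2| = l * T.
    by rewrite /x' /y' ![_ + l * _ - _]addrAC !subrr !add0r !normrM gtr0_norm
      // -mulrDr.
  have B1 : `|x' - b1| <= r by move: (normr_ge0 (y' - b2)); lra.
  have B2 : `|y' - b2| <= r by move: (normr_ge0 (x' - b1)); lra.
  have Z (u : R) : `|u - u| <= r by rewrite subrr normr0 ltW.
  have [H1 H2] := Hr _ _ B1 B2; have [H3 _] := Hr _ _ B1 (Z b2).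
  have [_ H4] := Hr _ _ (Z b1) B2.
  rewrite !addr0 /J; move: H1 H2 H3 H4; rewrite !mul1r !ler_norml.
  move: E1 le; clear; clearbody x' y'.
  move: (P _ _) (P _ _) (P _ _) (P _ _) (Q _ _) (Q _ _) (Q _ _) (Q _ _).
  by move: `|x' - b1| `|y' - b2| => *; lra.
exists (fun x y => P x b2 - P b1 b2 + (Q x y - Q x b2)) => x y xs ys e e0.
have [r r0 Hr] := loc _ _ _ xs ys e0.
pose r1 := Num.min (r / 2) (Num.min ((s - `|x - cx|) / 2) ((s - `|y - cy|) /
  2)).
exists r1; first by rewrite !lt_min; lra.
move=> x' y'; rewrite !le_min => /and3P[xr xr1 _] /and3P[yr _ yr1].
have x's : `|x' - cx| < s by have := ler_distD x x' cx; lra.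
have y's : `|y' - cy| < s by have := ler_distD y y' cy; lra.
have [||H1 _] := Hr x' y'; [lra|lra|].
have [||_ H2] := Hr x y'; [by rewrite subrr normr0 ltW|lra|].
have := Jb _ _ x's y's; have := Jb _ _ xs y's.
rewrite [leRHS]mulrDr => E1 E2.
rewrite (_ : _ - _ - _ - _ = (P x' y' - P x y' - p x y * (x' - x)) +
  (Q x y' - Q x y - q x y * (y' - y))).
  by apply: (le_trans (ler_normD _ _)); exact: lerD.
by move: E1 E2; rewrite /J; lra.
Unshelve. all: by end_near. Qed.

End primitives.

(** * Complex derivatives *)

(** Linear approximation with small relative error serves for [R] and [Cplx R] alike; over the
    latter, [e] and [r] are positive elements of that field. *)
Lemma is_derive_remainderP (K : numFieldType) (f : K -> K) (z l : K) :
  is_derive z 1 f l <->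
  (forall e, 0 < e -> exists2 r, 0 < r & forall w, `|w - z| <= r ->
     `|f w - f z - l * (w - z)| <= e * `|w - z|).
Proof.
have E h : h != 0 ->
    `|l - h^-1 *: (f (h *: 1 + z) - f z)| = `|f (h + z) - f z - l * h| / `|h|.
  move=> h0; rewrite -normfV -normrM -[in RHS]normrN.
  rewrite -![_ *: _]/(_ * _) mulr1; congr `|_|.
  by field.
split=> [[df dfl] e e0|H].
  have /cvgrPdist_le/(_ e e0) : h^-1 *: ((f \o shift z) (h *: 1) - f z)
      @[h --> 0^'] --> l by rewrite -dfl; exact: df.
  rewrite /dnbhs => /nbhs_normP[r /= r0 Hr]; exists (r / 2);
    first exact: divr_gt0.
  move=> w wr; have [->|wz] := eqVneq w z;
    first by rewrite !subrr mulr0 subr0 normr0 mulr0.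
  have h0 : w - z != 0 by rewrite subr_eq0.
  have := Hr (w - z); rewrite /ball_ /= sub0r normrN E // subrK => Hw.
  rewrite -ler_pdivrMr ?normr_gt0 //; apply: Hw => //.
  by apply: (le_lt_trans wr); rewrite ltr_pdivrMr // ltr_pMr // ltr1n.
have cv : h^-1 *: ((f \o shift z) (h *: 1) - f z) @[h --> 0^'] --> l.
  apply/cvgrPdist_le => e e0; have [r r0 Hr] := H e e0.
  rewrite /dnbhs; apply/nbhs_normP; exists r => // h /=.
  rewrite /ball_ /= sub0r normrN => hr h0.
  rewrite E // ler_pdivrMr ?normr_gt0 //.
  by have := Hr (h + z); rewrite addrK; apply; exact: ltW.
apply: DeriveDef; last exact/cvg_lim.
by apply/cvg_ex; exists l.
Qed.

(** * Modulus and coordinates of complex numbers *)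

Section complex_numbers.
Variable R : realType.
Local Notation C := (Cplx R).
Implicit Types (z w : C) (x y e r : R).

Lemma cplxE z : z = Complex (complex.Re z) (complex.Im z).
Proof. by case: z. Qed.

Lemma RecD z w : complex.Re (z + w) = complex.Re z + complex.Re w.
Proof. by case: z w => [? ?] [? ?]. Qed.
Lemma ImcD z w : complex.Im (z + w) = complex.Im z + complex.Im w.
Proof. by case: z w => [? ?] [? ?]. Qed.
Lemma RecN z : complex.Re (- z) = - complex.Re z.
Proof. by case: z => [? ?]. Qed.
Lemma ImcN z : complex.Im (- z) = - complex.Im z.
Proof. by case: z => [? ?]. Qed.
Lemma RecM z w : complex.Re (z * w) =
  complex.Re z * complex.Re w - complex.Im z * complex.Im w.
Proof. by case: z w => [? ?] [? ?]. Qed.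
Lemma ImcM z w : complex.Im (z * w) =
  complex.Re z * complex.Im w + complex.Im z * complex.Re w.
Proof. by case: z w => [? ?] [? ?]. Qed.

Lemma norm_cabs z : `|z| = ((cabs z)%:C)%C :> C.
Proof. by case: z. Qed.

Lemma cabs_ge0 z : 0 <= cabs z.
Proof. by case: z => a b; exact: sqrtr_ge0. Qed.
Lemma cabs0 : cabs (0 : C) = 0.
Proof. exact: ComplexField.Normc.normc0. Qed.
Lemma cabsM z w : cabs (z * w) = cabs z * cabs w.
Proof. exact: ComplexField.Normc.normcM. Qed.
Lemma cabsV z : cabs z^-1 = (cabs z)^-1.
Proof. exact: ComplexField.Normc.normcV. Qed.
Lemma cabsD z w : cabs (z + w) <= cabs z + cabs w.
Proof. exact: le_normcD. Qed.
Lemma cabsN z : cabs (- z) = cabs z.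
Proof. exact: normcN. Qed.
Lemma cabs_real x : cabs (Complex x 0 : C) = `|x|.
Proof. by rewrite /cabs /= expr0n addr0 sqrtr_sqr. Qed.
Lemma cabsX z n : cabs (z ^+ n) = cabs z ^+ n.
Proof.
elim: n => [|n IH]; last by rewrite !exprS cabsM IH.
by rewrite !expr0 -[1 : C]/(Complex 1 0) cabs_real normr1.
Qed.
Lemma cabs_eq0 z : (cabs z == 0) = (z == 0).
Proof.
apply/eqP/eqP => [|->]; [exact: ComplexField.Normc.eq0_normc|exact: cabs0].
Qed.
Lemma cabs_gt0 z : (0 < cabs z) = (z != 0).
Proof. by rewrite lt_def cabs_ge0 andbT cabs_eq0. Qed.
Lemma cabsB z w : cabs (z - w) = cabs (w - z).
Proof. by rewrite -cabsN opprB. Qed.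

Lemma normr_Re_cabs z : `|complex.Re z| <= cabs z.
Proof.
case: z => a b /=; rewrite /cabs /= -sqrtr_sqr ler_wsqrtr //.
by rewrite lerDl sqr_ge0.
Qed.
Lemma normr_Im_cabs z : `|complex.Im z| <= cabs z.
Proof.
case: z => a b /=; rewrite /cabs /= -sqrtr_sqr ler_wsqrtr //.
by rewrite lerDr sqr_ge0.
Qed.
Lemma cabs_le_ReIm z : cabs z <= `|complex.Re z| + `|complex.Im z|.
Proof.
case: z => a b /=; rewrite /cabs /= -(@ler_pXn2r _ 2) ?nnegrE ?addr_ge0 //.
rewrite sqr_sqrtr ?addr_ge0 ?sqr_ge0 // sqrrD !real_normK ?num_real //.
by rewrite lerD2r lerDl mulrn_wge0 // mulr_ge0.
Qed.

Lemma cplx_gt0P (e : C) : 0 < e -> exists2 r : R, 0 < r & e = (r%:C)%C.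
Proof. by case: e => a b; rewrite ltcE /= => /andP[/eqP -> a0]; exists a. Qed.

(** A positive element of [Cplx R] is a positive real, so tolerances and radii can be taken in
    [R]. *)
Lemma is_derive_cabsP (f : C -> C) (z l : C) :
  is_derive z 1 f l <->
  (forall e, 0 < e -> exists2 r, 0 < r & forall w, cabs (w - z) <= r ->
     cabs (f w - f z - l * (w - z)) <= e * cabs (w - z)).
Proof.
rewrite is_derive_remainderP; split=> H e e0.
  have eC : 0 < (e%:C)%C :> C by rewrite ltcE /= eqxx.
  have [_ /cplx_gt0P[r r0 ->] Hr] := H _ eC.
  exists r => // w wr; have := Hr w; rewrite !norm_cabs lecR => /(_ wr).
  by rewrite -rmorphM /= lecR.
have [{}e {}e0 ->] := cplx_gt0P e0; have [r r0 Hr] := H _ e0.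
exists (r%:C)%C; first by rewrite ltcE /= eqxx.
by move=> w; rewrite !norm_cabs -rmorphM /= !lecR; exact: Hr.
Qed.
End complex_numbers.

(** * Holomorphic primitives on a square *)

Section primitive_of_holomorphic.
Variable R : realType.
Local Notation C := (Cplx R).
Implicit Types (z w a b : C) (x y e r s t : R) (f g h : C -> C).

Definition open_box a s : set C :=
  [set z | `|complex.Re z - complex.Re a| < s /\
           `|complex.Im z - complex.Im a| < s].
Definition closed_box a s : set C :=
  [set z | `|complex.Re z - complex.Re a| <= s /\
           `|complex.Im z - complex.Im a| <= s].

Definition cabs_continuous_at f z :=
  forall e, 0 < e -> exists2 r, 0 < r & forall w, cabs (w - z) <= r ->
    cabs (f w - f z) <= e.

Lemma is_derive_cabs_continuous f z l :
  is_derive z 1 f l -> cabs_continuous_at f z.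
Proof.
move=> /is_derive_cabsP/(_ 1 ltr01)[r r0 Hr] e e0.
have l0 : 0 < cabs l + 1 by rewrite ltr_wpDl // cabs_ge0.
exists (Num.min r (e / (cabs l + 1))); first by rewrite lt_min r0 divr_gt0.
move=> w; rewrite le_min ler_pdivlMr // => /andP[/Hr{}Hr wl].
rewrite (_ : f w - f z = (f w - f z - l * (w - z)) + l * (w - z)); last by ring.
apply: (le_trans (cabsD _ _)); rewrite cabsM; apply: le_trans wl.
by move: (cabs _) (cabs _) (cabs _) Hr => A B D; lra.
Qed.

(** The form is the real part of [h dz]. If [h] has derivative [l], the Cauchy-Riemann equations
    make it closed: both cross derivatives are [- Im l]. *)
Lemma real_primitive h a b s : open_box a s b ->
  (forall z, closed_box a s z -> cabs_continuous_at h z) ->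
  (forall z, closed_box a s z -> z != b -> exists l, is_derive z 1 h l) ->
  exists F, forall z, open_box a s z ->
    has_differential F (complex.Re (h z)) (- complex.Im (h z))
      (complex.Re z) (complex.Im z).
Proof.
move=> [b1 b2] ch dh.
pose u x y : R := complex.Re (h (Complex x y)).
pose v x y : R := - complex.Im (h (Complex x y)).
have box_near (x y x' y' r : R) : `|x' - x| <= r / 2 -> `|y' - y| <= r / 2 ->
    cabs (Complex x' y' - Complex x y : C) <= r.
  by move=> ? ?; apply: (le_trans (cabs_le_ReIm _)) => /=; lra.
have [||F HF] := @closed_form_primitive R u v (complex.Re a) (complex.Im a) s
    (complex.Re b) (complex.Im b) b1 b2.
- move=> x y xs ys e e0; have [r r0 Hr] := ch (Complex x y) (conj xs ys) e e0.
  exists (r / 2); first by rewrite divr_gt0.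
  move=> x' y' xr yr; have := Hr _ (box_near _ _ _ _ _ xr yr).
  set d := _ - _ => dr; split.
    have -> : u x' y' - u x y = complex.Re d by rewrite RecD RecN.
    exact: le_trans (normr_Re_cabs _) dr.
  have -> : v x' y' - v x y = - complex.Im d by rewrite ImcD ImcN opprD.
  by rewrite normrN; exact: le_trans (normr_Im_cabs _) dr.
- move=> x y xs ys xyb.
  have [|l /is_derive_cabsP dl] := dh (Complex x y) (conj xs ys).
    by apply: contra_not_neq xyb => <-.
  exists (complex.Re l), (- complex.Im l), (- complex.Re l) => e e0.
  have [r r0 Hr] := dl _ e0; exists (r / 2); first by rewrite divr_gt0.
  move=> x' y' xr yr; have dr := Hr _ (box_near _ _ _ _ _ xr yr).
  have dxy : cabs (Complex x' y' - Complex x y : C) <= `|x' - x| + `|y' - y|.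
    exact: cabs_le_ReIm.
  have {}dr := le_trans dr (ler_wpM2l (ltW e0) dxy); split.
    apply: le_trans dr; apply: le_trans (normr_Re_cabs _).
    by rewrite !RecD !RecN RecM /= /u le_eqVlt; apply/orP; left; apply/eqP;
      congr `|_|; ring.
  apply: le_trans dr; apply: le_trans (normr_Im_cabs _).
  by rewrite -normrN !ImcD !ImcN ImcM /= /v le_eqVlt; apply/orP; left;
    apply/eqP; congr `|_|; ring.
by exists F => z [z1 z2]; have := HF _ _ z1 z2; rewrite /u /v -cplxE.
Qed.

Lemma holomorphic_primitive h a b s : open_box a s b ->
  (forall z, closed_box a s z -> cabs_continuous_at h z) ->
  (forall z, closed_box a s z -> z != b -> exists l, is_derive z 1 h l) ->
  exists H : C -> C, forall z, open_box a s z -> is_derive z 1 H (h z).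
Proof.
move=> bs ch dh; have [F1 HF1] := real_primitive bs ch dh.
(* This [i] is minus the imaginary unit: the imaginary part of [h dz] is the real part of
   [i * h dz]. *)
pose i : C := Complex 0 (-1).
have [||F2 HF2] := @real_primitive (fun z => i * h z) a b s bs.
- move=> z zs e e0; have [r r0 Hr] := ch z zs e e0; exists r => // w wr.
  rewrite -mulrBr cabsM [cabs i](_ : _ = 1) ?mul1r ?Hr //.
  by rewrite /cabs /= expr0n add0r sqrrN expr1n sqrtr1.
- move=> z zs zb; have [l dl] := dh z zs zb; exists (i *: l).
  exact: (@is_deriveZ _ _ _ h i z 1 l dl).
exists (fun z => Complex (F1 (complex.Re z) (complex.Im z))
  (F2 (complex.Re z) (complex.Im z))) => z zs.
(* Each of the two real coordinates costs [e / 4] times the sum of two increments, each at most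
   [cabs (w - z)]. *)
apply/is_derive_cabsP => e e0; have e4 : 0 < e / 4 by rewrite divr_gt0.
have [r1 r10 H1] := HF1 z zs _ e4; have [r2 r20 H2] := HF2 z zs _ e4.
exists (Num.min r1 r2); first by rewrite lt_min r10 r20.
move=> w; rewrite le_min => /andP[w1 w2].
have Rw := normr_Re_cabs (w - z); have Iw := normr_Im_cabs (w - z).
rewrite RecD RecN in Rw; rewrite ImcD ImcN in Iw.
have {}H1 := H1 _ _ (le_trans Rw w1) (le_trans Iw w1).
have {}H2 := H2 _ _ (le_trans Rw w2) (le_trans Iw w2).
apply: (le_trans (cabs_le_ReIm _)).
rewrite !RecD !RecN !ImcD !ImcN RecM ImcM /= RecD ImcD RecN ImcN.
rewrite RecM ImcM /= in H2.
have Ee : e / 4 * (`|complex.Re w - complex.Re z| +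
    `|complex.Im w - complex.Im z|) <= e / 2 * cabs (w - z).
  rewrite (_ : e / 2 * _ = e / 4 * (cabs (w - z) + cabs (w - z)));
    last by field.
  by rewrite ler_pM2l // lerD.
rewrite [leRHS](_ : _ = e / 2 * cabs (w - z) + e / 2 * cabs (w - z));
  last by field.
apply: lerD; [apply: le_trans Ee; apply: le_trans H1|
  apply: le_trans Ee; apply: le_trans H2];
  rewrite le_eqVlt; apply/orP; left; apply/eqP; congr `|_|; ring.
Qed.

End primitive_of_holomorphic.

(** * The Cauchy estimate *)

Section lipschitz.
Variable R : realType.
Local Notation C := (Cplx R).
Implicit Types (z w a b c : C) (e r s t : R) (f g h : C -> C).

Lemma is_derive_Re_curve f l (x y : R -> R) t (x' y' : R) :
  is_derive t 1 x x' -> is_derive t 1 y y' ->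
  is_derive (Complex (x t) (y t) : C) 1 f l ->
  is_derive t 1 (fun t => complex.Re (f (Complex (x t) (y t))))
    (complex.Re (l * (Complex x' y' : C))).
Proof.
move=> /is_derive_remainderP dx /is_derive_remainderP dy /is_derive_cabsP df.
apply/is_derive_remainderP => e e0.
set A := cabs (Complex x' y' : C); set L := cabs l.
have A0 : 0 <= A by exact: cabs_ge0.
have L0 : 0 <= L by exact: cabs_ge0.
(* With [d <= 1] the increment of the curve is at most [A + 2] times that of [t]. With
   [L * d <= e / 4] the remainder of the curve costs at most [e / 2]; the other half pays for the
   remainder of [f]. *)
pose d := Num.min 1 (e / 4 / (L + 1)).
have d0 : 0 < d by rewrite lt_min ltr01 !divr_gt0 // ltr_wpDl.
have [d1 dL] : d <= 1 /\ L * d <= e / 4.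
  have : d <= d by []; rewrite {2}/d le_min => /andP[-> dle]; split => //.
  have : d * (L + 1) <= e / 4 by rewrite -ler_pdivlMr // ltr_wpDl.
  by move: d0; rewrite mulrDr mulr1 mulrC; lra.
have e1 : 0 < e / 2 / (A + 2) by rewrite !divr_gt0 // ltr_wpDl.
have [r r0 Hr] := df _ e1; have [r1 r10 Hx] := dx _ d0.
have [r2 r20 Hy] := dy _ d0.
exists (Num.min (r / (A + 2)) (Num.min r1 r2)).
  by rewrite !lt_min r10 r20 divr_gt0 // ltr_wpDl.
move=> t'; rewrite !le_min => /and3P[tr /Hx{}Hx /Hy{}Hy].
set D : C := Complex (x t') (y t') - Complex (x t) (y t).
pose T : C := Complex (t' - t) 0.
have Tabs : cabs T = `|t' - t| by exact: cabs_real.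
have rem : cabs (D - Complex x' y' * T) <= 2 * d * `|t' - t|.
  apply: (le_trans (cabs_le_ReIm _)).
  rewrite RecD ImcD RecN ImcN RecM ImcM /= !mulr0 subr0 add0r.
  by rewrite -mulrA [leRHS]mulrDl mul1r; exact: lerD.
have Dle : cabs D <= (A + 2) * `|t' - t|.
  rewrite -[D](subrK (Complex x' y' * T)); apply: (le_trans (cabsD _ _)).
  rewrite cabsM Tabs -/A mulrDl addrC lerD2l; apply: (le_trans rem).
  by rewrite ler_wpM2r // ger_pMr.
have Dr : cabs D <= r.
  by apply: (le_trans Dle); rewrite mulrC -ler_pdivlMr // ltr_wpDl.
rewrite (_ : _ - _ - _ = complex.Re ((f (Complex (x t') (y t')) -
  f (Complex (x t) (y t)) - l * D) + l * (D - Complex x' y' * T))); last first.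
  rewrite !(RecD, RecN, RecM, ImcD, ImcN, ImcM) /=; ring.
apply: (le_trans (normr_Re_cabs _)); apply: (le_trans (cabsD _ _)).
have H1 := Hr _ Dr; have : e / 2 / (A + 2) * cabs D <= e / 2 * `|t' - t|.
  rewrite -mulrA ler_pM2l ?divr_gt0 // mulrC ler_pdivrMr ?ltr_wpDl //.
  by rewrite mulrC.
have : cabs (l * (D - Complex x' y' * T)) <= e / 2 * `|t' - t|.
  rewrite cabsM -/L; apply: (le_trans (ler_wpM2l L0 rem)).
  rewrite mulrA ler_wpM2r //; lra.
move: H1; rewrite -/D; lra.
Qed.

(** The real part of [f] is periodic in the angle, so Rolle's theorem gives a critical angle; the
    tangent to the circle at [w] is [w] times the imaginary unit. *)
Lemma circle_rolle f f' (r : R) :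
  (forall w, cabs w = r -> is_derive w 1 f (f' w)) -> 0 < r ->
  exists2 w, cabs w = r & complex.Re (f' w * (w * (Complex 0 1 : C))) = 0.
Proof.
move=> df r0; pose x t := r * cos t; pose y t := r * sin t.
have dx t : is_derive t 1 x (- (r * sin t)).
  by rewrite -mulrN; apply: (@is_deriveZ _ _ _ cos r t 1 (- sin t)).
have dy t : is_derive t 1 y (r * cos t).
  exact: (@is_deriveZ _ _ _ sin r t 1 (cos t)).
have xy t : cabs (Complex (x t) (y t) : C) = r.
  by rewrite /cabs /= !exprMn -mulrDr cos2Dsin2 mulr1 sqrtr_sqr gtr0_norm.
have dF t := is_derive_Re_curve (dx t) (dy t) (df _ (xy t)).
have pi2 : 0 < pi *+ 2 :> R by rewrite mulrn_wgt0 // pi_gt0.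
have [|||t _ dFt] := Rolle pi2 (f := fun t => complex.Re (f (Complex (x t) (y
  t)))).
- by move=> t _; have [] := dF t.
- apply: continuous_subspaceT => t; apply: differentiable_continuous.
  by apply/derivable1_diffP; have [] := dF t.
- by rewrite /x /y cos2pi sin2pi cos0 sin0.
exists (Complex (x t) (y t)) => //.
have := @derive_val _ _ _ _ _ _ _ dFt; have := @derive_val _ _ _ _ _ _ _ (dF t).
move=> -> E; rewrite -[RHS]E; congr complex.Re; congr (_ * _).
by apply/eqP; rewrite eq_complex /= /x /y; apply/andP; split; apply/eqP; ring.
Qed.

(** Multiplying by a conjugate turns a modulus into a real part, to which the real theorems
    apply. *)
Lemma Re_conjcM z : complex.Re ((conjc z : C) * z) = cabs z ^+ 2.
Proof.
case: z => a b; rewrite /cabs /= sqr_sqrtr ?addr_ge0 ?sqr_ge0 //; ring.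
Qed.

Lemma cabs_conjc z : cabs (conjc z : C) = cabs z.
Proof. by case: z => a b; rewrite /cabs /= sqrrN. Qed.

End lipschitz.

(** * Mean value and Lipschitz bounds for holomorphic functions *)

Section lipschitz_bound.
Variable R : realType.
Local Notation C := (Cplx R).
Implicit Types (z w a b c : C) (e r s t M : R) (f g h : C -> C).

Lemma is_derive_translate f l b w :
  is_derive (b + w) 1 f l -> is_derive w 1 (fun z => f (b + z)) l.
Proof.
move=> /is_derive_cabsP df; apply/is_derive_cabsP => e e0.
have [r r0 Hr] := df e e0; exists r => // z zr.
have E : b + z - (b + w) = z - w by ring.
by have := Hr (b + z); rewrite E; exact.
Qed.

Lemma is_derive_div_id f l w : w != 0 -> is_derive w 1 f l ->
  is_derive w 1 (fun z => f z / z) (l / w - f w / w ^+ 2).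
Proof.
move=> w0 df.
have dV : is_derive w 1 (fun z : C => z^-1) (- w ^- 2).
  apply: DeriveDef; first exact: derivableV.
  by rewrite deriveV // derive_id -[_ *: _]/(_ * _) mulr1.
apply: is_derive_eq (is_deriveM df dV) _.
by rewrite -![_ *: _]/(_ * _); field.
Qed.

(** On the segment from [w] to [z], the real part of [conjc D * H] increases by exactly
    [cabs D ^+ 2]. The real mean value theorem bounds this, and one factor [cabs D] cancels. *)
Lemma box_mean_value H h a s M : 
  (forall z, open_box a s z -> is_derive z 1 H (h z)) ->
  (forall z, open_box a s z -> cabs (h z) <= M) ->
  forall z w, open_box a s z -> open_box a s w ->
    cabs (H z - H w) <= M * cabs (z - w).
Proof.
move=> dH hM z w zs ws; set D := H z - H w.
have [D0|D0] := eqVneq D 0.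
  have M0 : 0 <= M by apply: le_trans (hM _ zs); exact: cabs_ge0.
  by rewrite D0 cabs0 mulr_ge0 // cabs_ge0.
rewrite -cabs_gt0 in D0.
pose k : C := conjc D.
pose x t := complex.Re w + t * (complex.Re z - complex.Re w).
pose y t := complex.Im w + t * (complex.Im z - complex.Im w).
have dx t : is_derive t 1 x (complex.Re z - complex.Re w).
  apply/is_derive_remainderP => e e0; exists 1 => // t' _.
  by rewrite (_ : _ - _ - _ = 0) ?normr0 ?mulr_ge0 ?(ltW e0) // /x; ring.
have dy t : is_derive t 1 y (complex.Im z - complex.Im w).
  apply/is_derive_remainderP => e e0; exists 1 => // t' _.
  by rewrite (_ : _ - _ - _ = 0) ?normr0 ?mulr_ge0 ?(ltW e0) // /y; ring.
have inbox t : 0 <= t <= 1 -> open_box a s (Complex (x t) (y t)).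
  move=> t01; case: zs => [z1 z2]; case: ws => [w1 w2].
  by split; exact: normr_segment_lt.
have dkH u : open_box a s u -> is_derive u 1 (fun v => k * H v) (k * h u).
  by move=> us; exact: (@is_deriveZ _ _ _ H k u 1 (h u) (dH _ us)).
pose F t := complex.Re (k * H (Complex (x t) (y t))).
pose F' t := complex.Re (k * h (Complex (x t) (y t)) * (z - w)).
have dF t : 0 <= t <= 1 -> is_derive t 1 F (F' t).
  move=> t01; rewrite /F'; have -> : z - w =
      Complex (complex.Re z - complex.Re w) (complex.Im z - complex.Im w).
    by case: (z) (w) => [? ?] [? ?].
  exact: is_derive_Re_curve (dx t) (dy t) (dkH _ (inbox t t01)).
have [||t + E] := @MVT_segment R F F' 0 1 ler01.
- by move=> t t01; apply: dF; rewrite !ltW //; move: t01;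
    rewrite in_itv => /andP[].
- apply: continuous_in_subspaceT => t /set_mem /= t01.
  apply: differentiable_continuous; apply/derivable1_diffP.
  by case: (dF t); move: t01; rewrite in_itv.
rewrite in_itv /= => t01; move: E; rewrite subr0 mulr1.
have -> : F 1 - F 0 = cabs D ^+ 2.
  rewrite -Re_conjcM /F /x /y !mul1r !mul0r !addr0 !subrKC -!cplxE.
  by rewrite /D mulrBr RecD RecN.
move=> E; rewrite -(ler_pM2l D0) -expr2 E.
apply: (le_trans (ler_norm _)); apply: (le_trans (normr_Re_cabs _)).
rewrite !cabsM cabs_conjc -mulrA ler_pM2l // ler_wpM2r ?cabs_ge0 //.
exact: hM (inbox t t01).
Qed.

(** Circles of radius [s / 2] about points of the quarter box stay in the box, as
    [s / 4 + s / 2 < s]; that radius is the denominator of the constant. *)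
Lemma holomorphic_lipschitz g a s M : 0 < s ->
  (forall z, closed_box a s z -> exists l, is_derive z 1 g l) ->
  (forall z, closed_box a s z -> cabs (g z) <= M) ->
  forall b c, closed_box a (s / 4) b -> closed_box a (s / 4) c ->
    cabs (g b - g c) <= M / (s / 2) * cabs (b - c).
Proof.
move=> s0 dg gM b c bs cs.
have cg z : closed_box a s z -> cabs_continuous_at g z.
  by move=> /dg[l]; exact: is_derive_cabs_continuous.
have sub z r : r < s -> closed_box a r z -> open_box a s z.
  by move=> rs [z1 z2]; split; [exact: le_lt_trans rs|exact: le_lt_trans rs].
have obs z : open_box a s z -> closed_box a s z by move=> [? ?]; split;
  exact: ltW.
have s4 : s / 4 < s by lra.
(* [g] has no exceptional point, so the center stands in for it in the construction of [G]. *)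
have as_ : open_box a s a by split; rewrite subrr normr0.
have [G dG] := holomorphic_primitive as_ cg (fun z zs _ => dg z zs).
(* The difference quotient extends continuously to d, so it too has a
  primitive. *)
have [K dK] : exists K : C -> C -> C, forall d z, closed_box a (s / 4) d ->
    open_box a s z -> z != d -> is_derive z 1 (K d) ((g z - g d) / (z - d)).
  have /choice[K HK] : forall d, exists Kd : C -> C, closed_box a (s / 4) d ->
    forall z,
      open_box a s z -> z != d -> is_derive z 1 Kd ((g z - g d) / (z - d)).
    move=> d; have [ds|] := pselect (closed_box a (s / 4) d); last by exists 0.
    have [l dl] := dg d (obs _ (sub _ _ s4 ds)).
    pose k z := if z == d then l else (g z - g d) / (z - d).
    have dk z : closed_box a s z -> z != d -> exists l, is_derive z 1 k l.
      move=> zs zd; have [lz dlz] := dg z zs.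
      have zd0 : z - d != 0 by rewrite subr_eq0.
      have d1 : is_derive (z - d) 1 (fun v => g (d + v) - g d) lz.
        apply: is_derive_eq (is_deriveB _ (is_derive_cst (g d) _ _)) (subr0 _).
        by apply: is_derive_translate; rewrite addrC subrK.
      have [m dm] : exists m, is_derive z 1 (fun v => (g v - g d) / (v - d)) m.
        have [m dm] : exists m, is_derive (- d + z) 1 (fun v => (g (d + v) - g
          d) / v) m.
          by eexists; rewrite addrC; exact: is_derive_div_id zd0 d1.
        exists m; rewrite (_ : (fun v => _) =
            fun v => (g (d + (- d + v)) - g d) / (- d + v)).
          exact: (is_derive_translate (f := fun v => (g (d + v) - g d) / v)).
        by apply: funext => v; rewrite addNKr [- d + v]addrC.
      exists m; apply/is_derive_cabsP => e e0;
        move/is_derive_cabsP: dm => /(_ e e0)[r r0 Hr].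
      have zd1 : 0 < cabs (z - d) by rewrite cabs_gt0.
      (* Half the distance to [d] keeps [w] away from [d], where [k] takes its filled-in value. *)
      exists (Num.min r (cabs (z - d) / 2));
        first by rewrite lt_min r0 divr_gt0.
      move=> w; rewrite le_min => /andP[wr wz]; rewrite /k (negPf zd) ifF;
        last first.
        by apply/eqP => wd; move: wz; rewrite wd cabsB; lra.
      exact: Hr.
    have [||Kd HKd] := @holomorphic_primitive R k a d s (sub _ _ s4 ds).
    - move=> z zs; have [->|zd] := eqVneq z d; last first.
        by have [m] := dk z zs zd; exact: is_derive_cabs_continuous.
      move=> e e0; move/is_derive_cabsP: dl => /(_ e e0)[r r0 Hr];
        exists r => // w wr.
      rewrite /k eqxx; have [_|wd] := eqVneq w d;
        first by rewrite subrr cabs0 ltW.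
      have wd0 : w - d != 0 by rewrite subr_eq0.
      rewrite (_ : _ - l = (g w - g d - l * (w - d)) / (w - d)); last by field.
      by rewrite cabsM cabsV ler_pdivrMr ?cabs_gt0 // Hr.
    - exact: dk.
    by exists Kd => _ z zs zd; have := HKd z zs; rewrite /k (negPf zd).
  by exists K => d z ds; exact: HK.
set D := g b - g c; have [D0|D0] := eqVneq D 0.
  have M0 : 0 <= M by apply: le_trans (gM _ (obs _ as_)); exact: cabs_ge0.
  by rewrite D0 cabs0 mulr_ge0 ?cabs_ge0 // divr_ge0 //; lra.
(* [Complex 0 (-1)] undoes the imaginary unit in the tangent of the circle, and [conjc D] makes the
   term in [D] real. *)
pose k : C := conjc D * Complex 0 (-1).
pose f w := k * (K b (b + w) - K c (c + w) - (G (b + w) - G (c + w)) / w).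
have s2 : 0 < s / 2 by rewrite divr_gt0.
have circle d w : closed_box a (s / 4) d -> cabs w = s / 2 -> open_box a s (d +
  w).
  move=> [d1 d2] ws; have := normr_Re_cabs w; have := normr_Im_cabs w;
    rewrite ws.
  by split; rewrite (RecD, ImcD) addrAC; apply: (le_lt_trans (ler_normD _ _));
    lra.
have w_neq0 w : cabs w = s / 2 -> w != 0 by rewrite -cabs_gt0 => ->.
have neq_base d w : cabs w = s / 2 -> d + w != d.
  by move=> /w_neq0; apply: contra_neq => /(canRL (addKr d)) ->; rewrite addNr.
(* The values of [g] on the two circles cancel in the derivative; only those at [b] and [c] remain,
   through [D]. *)
pose f' w := k * ((G (b + w) - G (c + w)) / w ^+ 2 - D / w).
have df w : cabs w = s / 2 -> is_derive w 1 f (f' w).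
  move=> ws; have w0 := w_neq0 w ws.
  have [ob oc] := (circle b w bs ws, circle c w cs ws).
  have dKb := is_derive_translate (dK b _ bs ob (neq_base b w ws)).
  have dKc := is_derive_translate (dK c _ cs oc (neq_base c w ws)).
  have dGq := is_derive_div_id w0 (is_deriveB (is_derive_translate (dG _ ob))
    (is_derive_translate (dG _ oc))).
  apply: is_derive_eq (is_deriveZ k (is_deriveB (is_deriveB dKb dKc) dGq)) _.
  rewrite -[_ *: _]/(_ * _) /f'; congr (k * _).
  rewrite /D -![(_ - _ : C -> C) _]/(_ - _); by field.
have [w ws] := circle_rolle df s2.
have w0 := w_neq0 w ws; rewrite /f' (_ : k * _ * _ = (conjc D : C) *
    ((G (b + w) - G (c + w)) / w) - (conjc D : C) * D); last first.
  rewrite /k (_ : conjc D * _ * _ * _ = conjc D * (Complex 0 (-1) * Complex 0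
    1) *
    ((G (b + w) - G (c + w)) / w - D)); last by field.
  by rewrite (_ : _ * Complex 0 1 = 1) ?mulr1 ?mulrBr //; apply/eqP;
    rewrite eq_complex /=; apply/andP; split; apply/eqP; ring.
rewrite RecD RecN Re_conjcM => /eqP; rewrite subr_eq0 => /eqP E.
have Dp : 0 < cabs D by rewrite cabs_gt0.
rewrite -(ler_pM2l Dp) -expr2 -E; apply: (le_trans (ler_norm _)).
apply: (le_trans (normr_Re_cabs _)); rewrite cabsM cabs_conjc ler_pM2l //.
rewrite cabsM cabsV ws mulrAC ler_wpM2r ?invr_ge0 ?(ltW s2) //.
have := box_mean_value dG (fun z zs => gM z (obs z zs)) (circle b w bs ws)
  (circle c w cs ws).
by rewrite (_ : b + w - (c + w) = b - c) //; ring.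
Qed.

End lipschitz_bound.

(** * Level sets near a zero *)

Section near_a_zero.
Variable R : realType.
Local Notation C := (Cplx R).
Implicit Types (z w a : C) (U : set C) (f g : C -> C) (e r L : R).

Lemma open_cabs_ball U a : open U -> U a ->
  exists2 r, 0 < r & forall z, cabs (z - a) <= r -> U z.
Proof.
move=> /[apply] /nbhs_normP[_ /= /cplx_gt0P[r r0 ->] Ur].
exists (r / 2) => [|z zr]; first by rewrite divr_gt0.
apply: Ur; rewrite /ball_ /= distrC norm_cabs ltcR; apply: (le_lt_trans zr).
by rewrite ltr_pdivrMr // ltr_pMr // ltr1n.
Qed.

Lemma holomorphic_on_is_derive U f z : holomorphic_on U f -> U z ->
  exists l, is_derive z 1 f l.
Proof. by move=> hf Uz; eexists; apply: derivableP; exact: hf. Qed.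

(** On a small box continuity keeps [cabs (g z)] between half and twice [cabs (g a)]; the upper
    bound feeds the Cauchy estimate. *)
Lemma holomorphic_locally_lipschitz U g a : open U -> U a ->
  holomorphic_on U g -> g a != 0 ->
  exists r L, [/\ 0 < r, 0 <= L &
    (forall z, cabs (z - a) <= r -> cabs (g a) / 2 <= cabs (g z)) /\
    (forall z w, cabs (z - a) <= r -> cabs (w - a) <= r ->
       cabs (g z - g w) <= L * cabs (z - w))].
Proof.
move=> oU Ua hg ga0; rewrite -cabs_gt0 in ga0.
have [r r0 Ur] := open_cabs_ball oU Ua.
have [l dl] := holomorphic_on_is_derive hg Ua.
have ga2 : 0 < cabs (g a) / 2 by rewrite divr_gt0.
have [r1 r10 Hr1] := is_derive_cabs_continuous dl ga2.
pose s := Num.min r r1 / 2.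
have s0 : 0 < s by rewrite divr_gt0 // lt_min r0.
have box_ball z : closed_box a s z -> cabs (z - a) <= r /\ cabs (z - a) <= r1.
  move=> [z1 z2]; apply/andP; rewrite -le_min;
    apply: (le_trans (cabs_le_ReIm _)).
  by rewrite RecD RecN ImcD ImcN; move: z1 z2; rewrite /s; lra.
have ball_box z t : cabs (z - a) <= t -> closed_box a t z.
  move=> zt; split; rewrite -?RecN -?ImcN -?RecD -?ImcD.
    exact: le_trans (normr_Re_cabs _) zt.
  exact: le_trans (normr_Im_cabs _) zt.
have gM z : closed_box a s z -> cabs (g z) <= 2 * cabs (g a).
  move=> /box_ball[_ /Hr1 E]; rewrite -[g z](subrK (g a)).
  by apply: (le_trans (cabsD _ _)); lra.
have dg z : closed_box a s z -> exists l, is_derive z 1 g l.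
  by move=> /box_ball[/Ur Uz _]; exact: holomorphic_on_is_derive hg Uz.
have H := holomorphic_lipschitz s0 dg gM.
exists (s / 4), (2 * cabs (g a) / (s / 2)); split.
- by rewrite divr_gt0.
- by rewrite divr_ge0 //; lra.
split=> [z zs|z w zs ws]; last by apply: H; exact: ball_box.
have [|_ /Hr1] := box_ball z; first by apply: ball_box; apply: (le_trans zs);
  lra.
have := cabsD (g a - g z) (g z); rewrite subrK [cabs (g a - _)]cabsB; lra.
Qed.

Definition direction z : C := z / (Complex (cabs z) 0 : C).

Lemma cabs_direction z : z != 0 -> cabs (direction z) = 1.
Proof.
rewrite -cabs_gt0 => z0; rewrite cabsM cabsV.
by rewrite cabs_real gtr0_norm // divff // gt_eqF.
Qed.

(* On a level set of f = (z - a)^n g the radius is a slowly varying function of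
   position, so the direction from a controls the distance. *)
Lemma level_set_direction a f g (n : nat) (c L r rho e : R) :
  (0 < n)%N -> 0 < c -> 0 <= L -> r * L <= c / 2 -> 0 < e ->
  (forall z, cabs (z - a) <= r -> f z = (z - a) ^+ n * g z) ->
  (forall z, cabs (z - a) <= r -> c <= cabs (g z)) ->
  (forall z w, cabs (z - a) <= r -> cabs (w - a) <= r ->
     cabs (g z - g w) <= L * cabs (z - w)) ->
  forall z w, cabs (z - a) <= r -> cabs (w - a) <= r ->
    cabs (f z) = e -> cabs (f w) = e -> cabs (w - a) <= rho -> cabs (z - a) <=
      rho ->
    cabs (z - w) <= 2 * rho * cabs (direction (z - a) - direction (w - a)).
Proof.
move=> n0 c0 L0 rL e0 fE gc gL z w.
wlog AB : z w / cabs (z - a) <= cabs (w - a).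
  move=> H zr wr fz fw wrho zrho;
    have [/H|/ltW/H] := leP (cabs (z - a)) (cabs (w - a)).
    exact.
  rewrite [in X in _ -> X]cabsB [cabs (direction (z - a) - _)]cabsB.
  by move=> /(_ wr zr fw fz zrho wrho).
move=> zr wr fz fw wrho zrho.
set A := cabs (z - a) in AB zr zrho *; set B := cabs (w - a) in AB wr wrho *.
have zf : A ^+ n * cabs (g z) = e by rewrite -cabsX -cabsM -fE.
have wf : B ^+ n * cabs (g w) = e by rewrite -cabsX -cabsM -fE.
have A0 : 0 < A.
  rewrite cabs_gt0; apply: contra_eq_neq zf => /eqP;
    rewrite -cabs_eq0 -/A => /eqP ->.
  by rewrite expr0n eqn0Ngt n0 mul0r lt_eqF.
have B0 : 0 < B := lt_le_trans A0 AB.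
(* Equal values of [f] give [(B^n - A^n) |g z| = B^n (|g z| - |g w|)], at most [B^n L |z - w|]. The
   left side is at least [(B - A) B^(n-1) c], and dividing by [B^(n-1)] leaves [B L <= r L <= c / 2]
   as the factor of [|z - w|]. *)
have AB2 : B - A <= cabs (z - w) / 2.
  have Bn : 0 < B ^+ n.-1 by rewrite exprn_gt0.
  have h1 : (B - A) * B ^+ n.-1 <= B ^+ n - A ^+ n.
    rewrite -(prednK n0) /= !exprS mulrBl lerD2l lerN2 ler_wpM2l ?(ltW A0) //.
    by rewrite lerXn2r // nnegrE ltW.
  have h2 : (B ^+ n - A ^+ n) * cabs (g z) <= B ^+ n * (L * cabs (z - w)).
    rewrite mulrBl zf -wf -mulrBr ler_wpM2l ?exprn_ge0 ?(ltW B0) //.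
    apply: le_trans (gL _ _ zr wr).
    by have := cabsD (g z - g w) (g w); rewrite subrK; lra.
  have h3 : (B - A) * c <= r * L * cabs (z - w).
    have h4 : (B - A) * B ^+ n.-1 * c <= B ^+ n * (L * cabs (z - w)).
      apply: le_trans h2; apply: le_trans (ler_wpM2r (cabs_ge0 _) h1).
      by rewrite ler_wpM2l ?gc // mulr_ge0 ?subr_ge0 // ltW.
    have {h4} : (B - A) * c <= B * L * cabs (z - w).
      rewrite -(ler_pM2l Bn) (_ : _ * (B * _ * _) = B ^+ n * (L * cabs (z -
        w))).
        by apply: le_trans h4; rewrite mulrA [_ * (B - A)]mulrC.
      by rewrite -{2}(prednK n0) exprS; ring.
    move=> h; apply: (le_trans h).
    by rewrite -!mulrA ler_wpM2r ?mulr_ge0 ?cabs_ge0.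
  rewrite -(ler_pM2r c0); apply: (le_trans h3).
  have := ler_wpM2r (cabs_ge0 (z - w)) rL; lra.
have E (v : C) : 0 < cabs v -> v = direction v * (Complex (cabs v) 0 : C).
  move=> v0; rewrite /direction mulfVK // -cabs_eq0 cabs_real normr_eq0.
  by rewrite gt_eqF.
(* Moving first in direction and then in radius; the radial part [B - A] is absorbed by half of the
   left side, which gives the factor 2. *)
have : cabs (z - w) <= A * cabs (direction (z - a) - direction (w - a)) + (B -
  A).
  rewrite (_ : z - w = Complex A 0 * (direction (z - a) - direction (w - a)) +
     Complex (A - B) 0 * direction (w - a)).
    apply: (le_trans (cabsD _ _)); rewrite 2!cabsM !cabs_real cabs_direction.
      by rewrite mulr1 (gtr0_norm A0) ler0_norm ?subr_le0 // opprB.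
    by rewrite -cabs_gt0.
  rewrite (_ : Complex (A - B) 0 = Complex A 0 - Complex B 0 :> C); last first.
    by apply/eqP; rewrite eq_complex /= subr0 !eqxx.
  rewrite (_ : z - w = (z - a) - (w - a)); last by ring.
  by rewrite {1}[z - a]E // {1}[w - a]E // -/A -/B; ring.
move=> h; have : A * cabs (direction (z - a) - direction (w - a)) <=
   rho * cabs (direction (z - a) - direction (w - a)).
  by rewrite ler_wpM2r ?cabs_ge0.
lra.
Qed.

End near_a_zero.

(** * Cells of the unit circle and estimates at a single zero *)

Section circle_cells.
Variable R : realType.
Local Notation C := (Cplx R).

(** The two quantities are the cosine and the sine of [acos], both 1-Lipschitz in the angle. *)
Lemma acos_lipschitz_inv (x y : R) : -1 <= x <= 1 -> -1 <= y <= 1 ->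
  `|x - y| <= `|acos x - acos y| /\
  `|Num.sqrt (1 - x ^+ 2) - Num.sqrt (1 - y ^+ 2)| <= `|acos x - acos y|.
Proof.
move=> x1 y1; set s := acos x; set t := acos y.
have F (f f' : R -> R) : (forall u : R, is_derive u 1 f (f' u)) ->
    (forall u : R, `|f' u| <= 1) -> `|f s - f t| <= `|s - t|.
  move=> df f1.
  have := @mean_value_bound R f' f t `|s - t| 0 1 t s;
    rewrite mul0r subr0 mul1r; apply.
  - by move=> u _; rewrite subr0.
  - by rewrite subrr normr0.
  - by [].
rewrite -!sin_acos // -/s -/t.
have -> : x - y = cos s - cos t by rewrite !acosK // in_itv.
split; [apply: (F cos (fun u => - sin u))|apply: (F sin cos)] => u.
- by rewrite normrN ler_norml sin_geN1 sin_le1.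
- by rewrite ler_norml cos_geN1 cos_le1.
Qed.

Lemma circle_cells (N : nat) : (0 < N)%N ->
  exists key : C -> bool * 'I_(4 * N).+1, forall u v : C,
    cabs u = 1 -> cabs v = 1 -> key u = key v -> cabs (u - v) <= 2 / N%:R.
Proof.
move=> N0; have NR : 0 < N%:R :> R by rewrite ltr0n.
(* A cell records the half-plane and the angle up to [1 / N]. Since [acos] is at most pi, hence at
   most 4, the integer part is at most [4 * N] and [inord] never falls back on its default. *)
exists (fun u => (0 <= complex.Im u, inord (Num.truncn (N%:R * acos (complex.Re
  u))))).
move=> u v u1 v1 [sgn cell].
have range (w : C) : cabs w = 1 -> -1 <= complex.Re w <= 1.
  by move=> w1; rewrite -ler_norml -w1; exact: normr_Re_cabs.
have Im_abs (w : C) : cabs w = 1 -> `|complex.Im w| = Num.sqrt (1 - complex.Re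
  w ^+ 2).
  case: w => a b w1; rewrite -sqrtr_sqr /=; congr Num.sqrt.
  have : a ^+ 2 + b ^+ 2 = 1.
    have := congr1 (fun x => x ^+ 2) w1; rewrite /cabs /= sqr_sqrtr ?expr1n //.
    by rewrite addr_ge0 // sqr_ge0.
  by move=> <-; ring.
have small (w : C) : cabs w = 1 -> 0 <= N%:R * acos (complex.Re w) /\
    (Num.truncn (N%:R * acos (complex.Re w)) < (4 * N).+1)%N.
  move=> /range w1; have a0 := acos_ge0 w1; have api := acos_lepi w1.
  have x0 : 0 <= N%:R * acos (complex.Re w) by rewrite mulr_ge0 // ltW.
  split => //; rewrite ltnS -(ler_nat R); have /andP[tx _] := truncn_itv x0;
    apply: (le_trans tx).
  rewrite natrM mulrC ler_wpM2r ?(ltW NR) //; have := pihalf_02 R; lra.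
have [x0 xN] := small u u1; have [y0 yN] := small v v1.
have {}cell : Num.truncn (N%:R * acos (complex.Re u)) =
    Num.truncn (N%:R * acos (complex.Re v)).
  by have := congr1 val cell; rewrite /= !inordK.
have d : `|acos (complex.Re u) - acos (complex.Re v)| <= 1 / N%:R.
  rewrite ler_pdivlMr // -[X in _ * X](gtr0_norm NR) -normrM mulrC mulrBr.
  have := truncn_itv x0; have := truncn_itv y0; rewrite -cell -natr1.
  by rewrite ler_norml; lra.
have [d1 d2] := acos_lipschitz_inv (range u u1) (range v v1).
apply: (le_trans (cabs_le_ReIm _)); rewrite RecD RecN ImcD ImcN.
suff <- : `|Num.sqrt (1 - complex.Re u ^+ 2) - Num.sqrt (1 - complex.Re v ^+
  2)| =
    `|complex.Im u - complex.Im v| by lra.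
rewrite -!Im_abs //; have [u0|u0] := leP 0 (complex.Im u).
  by rewrite (ger0_norm u0) (ger0_norm (_ : 0 <= complex.Im v)) // -sgn.
have v0 : complex.Im v < 0 by rewrite ltNge -sgn -ltNge.
by rewrite (ltr0_norm u0) (ltr0_norm v0) opprK addrC distrC.
Qed.

(** From [c |z - a|^n <= |f z| <= e] follows [|z - a| <= (e / c)^(1/n)]. As [e < 1] and
    [n <= kappa], the exponent [1 / n] can be weakened to [1 / kappa], and the resulting radius
    serves as [rho] for the level set. *)
Lemma zero_estimates (U : set C) (f : C -> C) (a : C) (n kappa : nat) :
  open U -> U a -> has_order U f a n -> f a = 0 -> (n <= kappa)%N ->
  exists r D : R, [/\ 0 < r, 0 < D & forall e : R, 0 < e < 1 ->
    (forall z, cabs (z - a) <= r -> cabs (f z) <= e ->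
       cabs (z - a) <= D * e `^ (1 / kappa%:R)) /\
    (forall z w, cabs (z - a) <= r -> cabs (w - a) <= r ->
       cabs (f z) = e -> cabs (f w) = e ->
       cabs (z - w) <= 2 * (D * e `^ (1 / kappa%:R)) *
         cabs (direction (z - a) - direction (w - a)))].
Proof.
move=> oU Ua [g [hg ga0 fE]] fa0 nk.
(* Order 0 would give [f a = g a], which is nonzero. *)
have n0 : (0 < n)%N.
  by case: n fE {nk} => // /(_ a Ua); rewrite fa0 expr0 mul1r => /esym/eqP;
    rewrite (negPf ga0).
have [r1 r10 Ur] := open_cabs_ball oU Ua.
have [r2 [L [r20 L0 [gc gL]]]] := holomorphic_locally_lipschitz oU Ua hg ga0.
set c := cabs (g a) / 2 in gc; have c0 : 0 < c by rewrite divr_gt0 // cabs_gt0.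
(* The last bound yields [r * L <= c / 2]; adding 1 covers [L = 0]. *)
pose r := Num.min (Num.min r1 r2) (c / 2 / (L + 1)).
have r0 : 0 < r by rewrite !lt_min r10 r20 2?divr_gt0 // ltr_wpDl.
have [rr1 rr2 rL] : [/\ r <= r1, r <= r2 & r * L <= c / 2].
  have : r <= r by []; rewrite {2}/r !le_min => /andP[/andP[-> ->]].
  rewrite ler_pdivlMr ?ltr_wpDl // => h; split => //; apply: le_trans h.
  by rewrite ler_wpM2l ?(ltW r0) // lerDl.
pose D := c^-1 `^ (1 / n%:R).
have nR : 0 < n%:R :> R by rewrite ltr0n.
have radius e z : 0 < e < 1 -> cabs (z - a) <= r -> cabs (f z) <= e ->
    cabs (z - a) <= D * e `^ (1 / kappa%:R).
  move=> /andP[e0 e1] zr fz; set A := cabs (z - a).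
  have A0 : 0 <= A by exact: cabs_ge0.
  have An : A ^+ n <= c^-1 * e.
    rewrite mulrC ler_pdivlMr //; apply: le_trans fz.
    rewrite fE; last by apply: Ur; exact: le_trans rr1.
    rewrite cabsM cabsX ler_wpM2l ?exprn_ge0 // gc //; exact: le_trans rr2.
  have -> : A = (A ^+ n) `^ (1 / n%:R).
    by rewrite -powR_mulrn // -powRrM mulrC divfK ?gt_eqF // powRr1.
  apply: (@le_trans _ _ ((c^-1 * e) `^ (1 / n%:R))).
    by apply: ge0_ler_powR => //;
      rewrite ?nnegrE ?exprn_ge0 ?mulr_ge0 ?divr_ge0 ?invr_ge0 // ltW.
  rewrite powRM ?invr_ge0 ?(ltW c0) ?(ltW e0) // ler_wpM2l ?powR_ge0 //.
  apply: ger_powR; first by rewrite e0 ltW.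
  by rewrite !div1r lef_pV2 ?posrE ?ltr0n ?(leq_trans n0) // ler_nat.
exists r, D; split => //; first by rewrite powR_gt0 // invr_gt0.
move=> e e01; split; first by move=> z; exact: radius.
move=> z w zr wr fz fw.
apply: (@level_set_direction R a f g n c L r (D * e `^ (1 / kappa%:R)) e) => //.
- by case/andP: e01.
- by move=> v vr; apply: fE; apply: Ur; exact: le_trans rr1.
- by move=> v vr; apply: gc; exact: le_trans rr2.
- by move=> v v' vr v'r; apply: gL; exact: le_trans rr2.
- by apply: radius => //; rewrite fw.
- by apply: radius => //; rewrite fz.
Qed.

End circle_cells.

(** * Covers *)

Section covers.
Variable R : realType.
Local Notation C := (Cplx R).
Local Open Scope ereal_scope.

Lemma diam_le (A : set C) (d : R) : (0 <= d)%R ->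
  (forall z w, A z -> A w -> (cabs (z - w) <= d)%R) -> diam A <= d%:E.
Proof.
move=> d0 Ad; apply: ge_ereal_sup => _ [->|[[z w] [/= Az Aw] <-]].
  by rewrite lee_fin.
by rewrite lee_fin Ad.
Qed.

Lemma diam_ge0 (A : set C) : 0 <= diam A.
Proof. by apply: ereal_sup_ubound; left. Qed.

(** At every scale it suffices to give finitely many pieces with a common diameter bound [d]; their
    number times [d] bounds the sum. *)
Lemma hausdorff1_le (A : set C) (S : R) :
  (forall delta : R, (0 < delta)%R -> exists (T : finType) (P : T -> set C) (d
    : R),
     [/\ (0 <= d)%R, (d <= delta)%R, (#|T|%:R * d <= S)%R,
         A `<=` [set z | exists t, P t z] &
         forall t z w, P t z -> P t w -> (cabs (z - w) <= d)%R]) ->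
  hausdorff1 A <= S%:E.
Proof.
move=> H; apply: ge_ereal_sup => _ [delta /= delta0 <-].
have [T [P [d [d0 ddelta Sd AP Pd]]]] := H delta delta0.
(* The finite family is padded by empty sets, whose diameter is 0. *)
pose B (j : nat) : set C := if insub j is Some i then P (@enum_val T xpredT i)
  else set0.
have B0 j : (#|T| <= j)%N -> B j = set0.
  by move=> Tj; rewrite /B insubN // -leqNgt.
have Bd j : diam (B j) <= d%:E.
  apply: diam_le => // z w; rewrite /B; case: insubP => [i _ _|//]; exact: Pd.
apply: (@le_trans _ _ (\sum_(0 <= j <oo) diam (B j))).
  apply: ereal_inf_lbound; exists B => //; split=> [z /AP[t Pt]|j].
    exists (enum_rank t) => //; rewrite /B insubT // => lt.
    by rewrite (_ : Sub _ _ = enum_rank t) ?enum_rankK //; apply: val_inj.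
  by apply: (le_trans (Bd j)); rewrite lee_fin.
rewrite (nneseries_split 0 #|T|); last by move=> *; exact: diam_ge0.
rewrite add0n eseries0 ?adde0; last first.
  move=> i Ti _; rewrite B0 //; apply/eqP; rewrite eq_le diam_ge0 andbT.
  exact: diam_le.
apply: (@le_trans _ _ (\sum_(0 <= k < #|T|) d%:E)); first exact: lee_sum.
by rewrite sumEFin lee_fin sumr_const_nat subn0 -mulr_natl.
Qed.

(** Lebesgue measure is evaluated on every set as an outer measure, which is monotone on arbitrary
    sets. *)
Lemma lebesgue_measure_subset (A B : set R) : A `<=` B ->
  @lebesgue_measure R A <= @lebesgue_measure R B.
Proof. exact: (le_mu_ext (wlength idfun)). Qed.

(** The product measure integrates the measures of sections. The integral of a nonnegative function
    is a supremum over simple functions below it, and this grows with the integrand. *)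
Lemma product_lebesgue_subset (A B : set (R * R)) : A `<=` B ->
  (@lebesgue_measure R \x @lebesgue_measure R) A <=
  (@lebesgue_measure R \x @lebesgue_measure R) B.
Proof.
move=> AB; rewrite /product_measure1 !ge0_integralTE //.
apply: ereal_sup_le => _ [h /= hA <-]; exists h => // x;
  apply: (le_trans (hA x)).
by apply: lebesgue_measure_subset => y; rewrite /xsection /= !inE; exact: AB.
Qed.

(** Each disk is enlarged to a square of side [2 * rho], a measurable rectangle of known product
    measure; finite subadditivity does the rest. *)
Lemma area_le (T : finType) (a : T -> C) (rho : R) (A : set C) : (0 <= rho)%R ->
  (forall z, A z -> exists t, (cabs (z - a t) <= rho)%R) ->
  area A <= (#|T|%:R * (2 * rho) ^+ 2)%:E.
Proof.
move=> rho0 cover.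
pose side (c : R) : set (measurableTypeR R) := `[(c - rho)%R, (c +
  rho)%R]%classic.
pose Q t : set (measurableTypeR R * measurableTypeR R) := side (complex.Re (a
  t)) `*` side (complex.Im (a t)).
have mside c : measurable (side c) by exact: measurable_itv.
have mQ t : measurable (Q t) by exact: measurableX.
have QE t : (@lebesgue_measure R \x @lebesgue_measure R) (Q t) = ((2 * rho) ^+
  2)%:E.
  have sideE c : lebesgue_measure (side c) = (2 * rho)%:E.
    rewrite lebesgue_measure_itv /= lte_fin; case: ltP => [_|h].
      by rewrite -EFinD; congr EFin; ring.
    congr EFin; lra.
  transitivity (lebesgue_measure (side (complex.Re (a t))) *
    lebesgue_measure (side (complex.Im (a t)))); first exact: product_measure1E.
  by rewrite !sideE -EFinM expr2.
have union_le (s : seq T) : (@lebesgue_measure R \x @lebesgue_measure R)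
    (\big[setU/set0]_(t <- s) Q t) <= ((size s)%:R * (2 * rho) ^+ 2)%:E.
  elim: s => [|t s IH]; first by rewrite big_nil measure0 mul0r.
  rewrite big_cons; apply: (le_trans (measureU2 _ _ _)) => //.
    exact: bigsetU_measurable.
  rewrite (_ : (size (t :: s))%:R * _ = (2 * rho) ^+ 2 + (size s)%:R * (2 *
    rho) ^+ 2)%R.
    by rewrite EFinD; apply: leeD => //; rewrite -(QE t).
  by rewrite /= -natr1; ring.
rewrite cardT; apply: le_trans (union_le (enum T)).
apply: product_lebesgue_subset => -[x y] /= /cover[t zt].
rewrite -bigcup_seq; exists t; first by rewrite /= mem_enum.
have := normr_Re_cabs (Complex x y - a t);
  have := normr_Im_cabs (Complex x y - a t).
rewrite RecD ImcD RecN ImcN /= => yt xt.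
have := le_trans yt zt; have := le_trans xt zt; rewrite !ler_norml => h1 h2.
by split; rewrite /side /= in_itv /=; lra.
Qed.

End covers.

(** * Compactness of the closed disk *)

Section compactness.
Variable R : realType.
Local Notation C := (Cplx R).

Lemma small_values_near_zeros (T : finType) (a : T -> C) (r : T -> R)
    (U : set C) (f : C -> C) :
  closed_unit_disk `<=` U -> holomorphic_on U f -> (forall t, 0 < r t) ->
  (forall z, cabs z <= 1 -> f z = 0 -> exists t, z = a t) ->
  exists2 e : R, 0 < e & forall z, cabs z <= 1 -> cabs (f z) < e ->
    exists t, cabs (z - a t) <= r t.
Proof.
move=> DU hf r0 zeros.
pose I : set R := `[-1, 1]%classic.
have compactK : compact (I `*` I) by apply: compact_setX;
  exact: segment_compact.
(* Compactness is used on the square [I]-by-[I]; [P] holds vacuously at its points outside the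
   disk. *)
pose P (e : R) (p : R * R) := cabs (Complex p.1 p.2 : C) <= 1 ->
  cabs (f (Complex p.1 p.2)) < e ->
  exists t, cabs ((Complex p.1 p.2 : C) - a t) <= r t.
(* Three cases: off the closed disk a neighborhood misses it; near a zero the conclusion is
   immediate; elsewhere [cabs (f w)] stays above half of [cabs (f z)]. *)
have local (z : C) : exists2 s, 0 < s & exists2 d, 0 < d &
    forall w, cabs (w - z) <= s -> cabs w <= 1 -> cabs (f w) < d ->
      exists t, cabs (w - a t) <= r t.
  have [z1|z1] := leP (cabs z) 1; last first.
    exists ((cabs z - 1) / 2); first by lra.
    exists 1 => // w wz w1; have := cabsD (z - w) w; rewrite subrK cabsB; lra.
  have [fz|fz] := eqVneq (f z) 0.
    have [t ->] := zeros z z1 fz; exists (r t) => //; exists 1 => // w wt _ _.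
    by exists t.
  rewrite -cabs_gt0 in fz; have fz2 : 0 < cabs (f z) / 2 by rewrite divr_gt0.
  have [l dl] := holomorphic_on_is_derive hf (DU _ z1).
  have [s s0 Hs] := is_derive_cabs_continuous dl fz2.
  exists s => //; exists (cabs (f z) / 2) => // w /Hs wz _ fw.
  have := cabsD (f z - f w) (f w); rewrite subrK cabsB; lra.
have : \forall e \near (0 : R)^'+, I `*` I `<=` P e.
  apply: (proj1 (compact_near_coveringP _) compactK) => -[x y] _.
  have [s s0 [d d0 H]] := local (Complex x y).
  exists (ball (x, y) (s / 2), [set e : R | e < d]) => /=.
    split; first by apply: nbhsx_ballx; rewrite divr_gt0.
    exact: nbhs_right_lt.
  move=> [[x' y'] e] /= [[hx hy] ed] w1 fw; apply: H => //;
    last exact: lt_trans fw ed.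
  apply: (le_trans (cabs_le_ReIm _)); rewrite RecD ImcD RecN ImcN /=.
  move: hx hy; rewrite -!ball_normE /= [`|x - _|]distrC [`|y - _|]distrC; lra.
move=> near_e; have [e [e0 He]] : exists e : R, 0 < e /\ I `*` I `<=` P e.
  by apply: (@filter_ex _ (0 : R)^'+); near=> e; split; [|near: e].
exists e => // z z1 fz.
have zI : (I `*` I) (complex.Re z, complex.Im z).
  by split; rewrite /I /= in_itv /= -ler_norml;
    [exact: le_trans (normr_Re_cabs z) z1|exact: le_trans (normr_Im_cabs z) z1].
have Pz := He _ zI; move: Pz; rewrite /P (_ : Complex _ _ = z);
  last by rewrite -cplxE.
by apply.
Unshelve. all: by end_near. Qed.

End compactness.

(** * The two bounds, assembled from the estimates at each zero *)

Theorem corollary1p3 (R : realType) (U : set (Cplx R)) (f : Cplx R -> Cplx R)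
  (U_open : open U) (U_connected : connected U)
  (U_disk : closed_unit_disk `<=` U)
  (f_holo : holomorphic_on U f)
  (f_neq0 : exists2 z, U z & f z != 0)
  (m r : nat) (p : 'I_m -> Cplx R) (q : 'I_r -> Cplx R)
  (k : 'I_m -> nat) (l : 'I_r -> nat)
  (p_inj : injective p) (q_inj : injective q)
  (p_zeros : range p = [set z | unit_disk z /\ f z = 0])
  (q_zeros : range q = [set z | unit_circle z /\ f z = 0])
  (p_mult : forall i, has_order U f (p i) (k i))
  (q_mult : forall j, has_order U f (q j) (l j))
  (mr_ge1 : (1 <= m + r)%N) :
  let kappa := maxn (\max_(i < m) k i) (\max_(j < r) l j) in
  exists C e0 : R, [/\ 0 < C, 0 < e0 &
    forall e : R, 0 < e < e0 ->
      (hausdorff1 (level_set f e) <= (C * e `^ (1 / kappa%:R))%:E)%E /\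
      (area (sublevel_set f e) <= (C * e `^ (2 / kappa%:R))%:E)%E].
Proof.
move=> kappa.
(* Interior and boundary zeros are treated alike from here on, indexed by one finite type. *)
pose T : finType := ('I_m + 'I_r)%type.
pose a (t : T) := match t with inl i => p i | inr j => q j end.
pose n (t : T) := match t with inl i => k i | inr j => l j end.
have a_zero t : cabs (a t) <= 1 /\ f (a t) = 0.
  case: t => [i|j] /=.
    have : range p (p i) by exists i.
    by rewrite p_zeros => -[/ltW].
  have : range q (q j) by exists j.
  by rewrite q_zeros => -[/= -> ->].
have all_zeros z : cabs z <= 1 -> f z = 0 -> exists t, z = a t.
  rewrite le_eqVlt => /predU1P[z1|z1] fz.
    have [j _ <-] : range q z by rewrite q_zeros.
    by exists (inr j).
  have [i _ <-] : range p z by rewrite p_zeros.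
  by exists (inl i).
have a_order t : has_order U f (a t) (n t) by case: t.
have n_le t : (n t <= kappa)%N.
  case: t => [i|j] /=.
    exact: leq_trans (leq_bigmax i) (leq_maxl _ _).
  exact: leq_trans (leq_bigmax j) (leq_maxr _ _).
have /choice[rD HrD] : forall t, exists rD : R * R, [/\ 0 < rD.1, 0 < rD.2 &
    forall e : R, 0 < e < 1 ->
    (forall z, cabs (z - a t) <= rD.1 -> cabs (f z) <= e ->
       cabs (z - a t) <= rD.2 * e `^ (1 / kappa%:R)) /\
    (forall z w, cabs (z - a t) <= rD.1 -> cabs (w - a t) <= rD.1 ->
       cabs (f z) = e -> cabs (f w) = e ->
       cabs (z - w) <= 2 * (rD.2 * e `^ (1 / kappa%:R)) *
         cabs (direction (z - a t) - direction (w - a t)))].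
  move=> t; have [a1 fa] := a_zero t.
  have [rt [D [h1 h2 h3]]] := zero_estimates U_open (U_disk _ a1) (a_order t)
    fa (n_le t).
  by exists (rt, D).
(* One constant dominates those of all zeros; the summand 1 makes it positive. *)
pose D := 1 + \sum_t (rD t).2.
have D_ge t : (rD t).2 <= D.
  rewrite /D (bigD1 t) //= addrCA lerDl addr_ge0 // sumr_ge0 // => s _.
  by have [_ /ltW] := HrD s.
have D0 : 0 < D.
  by rewrite ltr_pwDl // sumr_ge0 // => s _; have [_ /ltW] := HrD s.
have r_gt0 t : 0 < (rD t).1 by have [] := HrD t.
have [e1 e10 near_zero] := small_values_near_zeros U_disk f_holo r_gt0
  all_zeros.
pose T' : R := #|T|%:R.
have T'0 : 0 <= T' by rewrite ler0n.
(* Length: each zero has [2 * (4 * N + 1) <= 10 * N] pieces of diameter at most [4 * D * E / N],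
   which gives 40. Area: [T'] squares of side [2 * D * E]. The final 1 gives positivity; [e < 1]
   serves the exponents and [e < e1] the localization near zeros. *)
exists (40 * T' * D + 4 * T' * D ^+ 2 + 1), (Num.min 1 e1); split.
- by rewrite ltr_wpDl // addr_ge0 // !mulr_ge0 // ?exprn_ge0 // ltW.
- by rewrite lt_min ltr01.
move=> e; rewrite lt_min => /and3P[e_gt0 e_lt1 e_lte1].
have e01 : 0 < e < 1 by rewrite e_gt0.
set E := e `^ (1 / kappa%:R) in HrD *.
have E0 : 0 <= E by exact: powR_ge0.
have DE0 : 0 <= D * E by rewrite mulr_ge0 // ltW.
split.
  apply: (@hausdorff1_le _ _ ((40 * T' * D + 4 * T' * D ^+ 2 + 1) * E)).
  move=> delta delta0.
  (* Large enough for the diameter bound [4 * (D * E) / N] to be at most [delta]. *)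
  pose N := (Num.truncn (4 * (D * E) / delta)).+1.
  have NR : 0 < N%:R :> R by rewrite ltr0n.
  have [//|key Hkey] := @circle_cells R N.
  exists (T * (bool * 'I_(4 * N).+1))%type, (fun tc => [set z |
    [/\ cabs (f z) = e, cabs (z - a tc.1) <= (rD tc.1).1 &
        key (direction (z - a tc.1)) = tc.2]]), (4 * (D * E) / N%:R).
  split.
  - by rewrite divr_ge0 ?mulr_ge0 // ltW.
  - by rewrite ler_pdivrMr // [leRHS]mulrC -ler_pdivrMr // ltW // truncnS_gt.
  - rewrite !card_prod card_bool card_ord !natrM -/T'.
    have N5 : (4 * N).+1%:R / N%:R <= 5 :> R.
      by rewrite ler_pdivrMr // -natrM ler_nat -add1n [(5 * N)%N]mulSn
        leq_add2r.
    rewrite (_ : _ * _ = 8 * T' * (D * E) * ((4 * N).+1%:R / N%:R)); last first.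
      by field; rewrite gt_eqF.
    have TDE : 0 <= T' * (D * E) by exact: mulr_ge0.
    apply: (@le_trans _ _ (40 * (T' * (D * E)))).
      by have := ler_wpM2l TDE N5; lra.
    have : 0 <= 4 * T' * D ^+ 2 * E by rewrite !mulr_ge0 // ?exprn_ge0 // ltW.
    lra.
  - move=> z [z1 fz]; have [|t tz] := near_zero z (ltW z1); first by rewrite fz.
    by exists (t, key (direction (z - a t))).
  move=> [t c] z w [fz zr zc] [fw wr wc]; have [_ _ /(_ e e01)[_ H]] := HrD t.
  (* A point of the level set is not a zero, as [e > 0], so its direction lies on the unit
     circle. *)
  have nz v : cabs (f v) = e -> v - a t != 0.
    move=> fv; rewrite subr_eq0; apply: contra_eq_neq fv => ->.
    by rewrite (a_zero t).2 cabs0 lt_eqF.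
  apply: (le_trans (H z w zr wr fz fw)).
  have := Hkey _ _ (cabs_direction (nz z fz)) (cabs_direction (nz w fw)).
  rewrite zc wc => /(_ erefl) dir.
  rewrite (_ : 4 * (D * E) / N%:R = 2 * (D * E) * (2 / N%:R)); last by field;
    rewrite gt_eqF.
  apply: ler_pM => //; rewrite ?mulr_ge0 ?cabs_ge0 //;
    first by have [_ /ltW] := HrD t.
  by rewrite ler_pM2l // ler_wpM2r.
have EE : e `^ (2 / kappa%:R) = E ^+ 2.
  by rewrite -powR_mulrn // -powRrM mul1r mulrC.
apply: (@le_trans _ _ (T' * (2 * (D * E)) ^+ 2)%:E).
  apply: (@area_le _ _ a) => // z [z1 fz].
  have [t tz] := near_zero z (ltW z1) (lt_trans fz e_lte1); exists t.
  have [_ _ /(_ e e01)[H _]] := HrD t; apply: (le_trans (H z tz (ltW fz))).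
  exact: ler_wpM2r.
rewrite EE lee_fin (_ : T' * _ = 4 * T' * D ^+ 2 * E ^+ 2); last by ring.
rewrite ler_wpM2r ?exprn_ge0 //.
have : 0 <= 40 * T' * D by rewrite !mulr_ge0 // ltW.
lra.
Qed.
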